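(* For each $n\ge 1$, let $X_n$ denote the number of improper edges in a uniformly random rooted labeled tree on $[n]=\{1,\ldots,n\}$. Put $\mu=e-2$ and $\sigma^2=e^2-3e+1$ (with $\sigma>0$). Then, as $n\to\infty$, $$\mathbb{E}X_n=\mu n-\frac{e}{2}+O(n^{-1}),\qquad \operatorname{Var}(X_n)=\sigma^2 n+\frac{e(3-e)}{2}+O(n^{-1}).$$ Moreover, $$\frac{X_n-\mu n}{\sigma\sqrt{n}}\xrightarrow{\mathrm{d}}\mathcal{N}(0,1),$$ i.e. the left-hand side converges in distribution to the standard normal law as $n\to\infty$.
   Context: A rooted labeled tree on $[n]=\{1,\ldots,n\}$ is a tree with vertex set $[n]$ together with a distinguished vertex (the root); it is unordered, i.e. the children of a vertex carry no linear order. Let $\mathscr{T}_n$ be the (finite) set of all rooted labeled trees on $[n]$, equipped with the uniform probability measure. Each vertex is identified with its label. An edge of $T\in\mathscr{T}_n$ is written $(i,j)$ with $i$ the parent of $j$. The edge $(i,j)$ is called proper if $i$ is smaller than the label of every vertex in the subtree rooted at $j$ (the subtree consisting of $j$ and all its descendants, including $j$ itself); otherwise it is called improper. *)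

(* Defs.v *)
From HB Require Import structures.
From mathcomp Require Import all_boot all_order all_algebra.
From mathcomp Require Import all_classical all_reals all_analysis.
Import Order.TTheory GRing.Theory Num.Theory.
Import numFieldNormedType.Exports.

Set Implicit Arguments.
Unset Strict Implicit.
Unset Printing Implicit Defensive.

Local Open Scope ring_scope.

(* The vertices are 'I_n = {0, ..., n - 1} instead of {1, ..., n}: only the
   relative order of the labels is ever used.  A simple graph is given by its
   symmetric irreflexive set of ordered adjacent pairs. *)
Definition graph (n : nat) : finType := {set 'I_n * 'I_n}.

Definition adj (n : nat) (E : graph n) : rel 'I_n := fun x y => (x, y) \in E.

Definition simple_graph (n : nat) (E : graph n) : Prop :=
  symmetric (adj E) /\ irreflexive (adj E).

Definition connected_graph (n : nat) (E : graph n) : Prop :=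
  forall x y : 'I_n, connect (adj E) x y.

(* ucycle also accepts an edge traversed back and forth, of size 2. *)
Definition acyclic_graph (n : nat) (E : graph n) : Prop :=
  forall c : seq 'I_n, (2 < size c)%N -> ~ ucycle (adj E) c.

Definition is_tree (n : nat) (E : graph n) : Prop :=
  [/\ simple_graph E, connected_graph E & acyclic_graph E].

Definition rooted_graph (n : nat) : finType := (graph n * 'I_n)%type.

Definition rooted_trees (n : nat) : {set rooted_graph n} :=
  [set T : rooted_graph n | `[< is_tree T.1 >]]%SET.

(* i is the last vertex before j on a simple path from the root to j. *)
Definition parent (n : nat) (T : rooted_graph n) : rel 'I_n :=
  fun i j => `[< exists p : seq 'I_n,
    [/\ path (adj T.1) T.2 (rcons p j), uniq (T.2 :: rcons p j)
      & last T.2 p = i] >].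

Definition subtree (n : nat) (T : rooted_graph n) (j : 'I_n) : {set 'I_n} :=
  [set v : 'I_n | connect (parent T) j v]%SET.

Definition proper_edge (n : nat) (T : rooted_graph n) (i j : 'I_n) : bool :=
  [forall v in subtree T j, (i < v)%N].

Definition improper_edges (n : nat) (T : rooted_graph n) : {set 'I_n * 'I_n} :=
  [set ij : 'I_n * 'I_n |
    parent T ij.1 ij.2 && ~~ proper_edge T ij.1 ij.2]%SET.

Definition nb_improper (n : nat) (T : rooted_graph n) : nat :=
  #|improper_edges T|.

(* The three operations below refer to the uniform probability measure on a
   nonempty finite set A. *)
Definition unif_prob (R : realType) (T : finType) (A : {set T}) (P : pred T)
  : R := #|[set t in A | P t]%SET|%:R / #|A|%:R.

Definition unif_expect (R : realType) (T : finType) (A : {set T}) (X : T -> R)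
  : R := (\sum_(t in A) X t) / #|A|%:R.

Definition unif_var (R : realType) (T : finType) (A : {set T}) (X : T -> R)
  : R := unif_expect A (fun t => (X t - unif_expect A X) ^+ 2).

(* F n is the cumulative distribution function of the n-th variable. *)
Definition cvg_in_distribution (R : realType) (F : nat -> R -> R)
    (mu : probability (measurableTypeR R) R) : Prop :=
  let G := fun x : R => fine (mu `]-oo, x]%classic) in
  forall x : R, {for x, continuous G} -> (F n x @[n --> \oo] --> G x)%classic.

Definition X (R : realType) (n : nat) (T : rooted_graph n) : R :=
  (nb_improper T)%:R.
Arguments X R n T : clear implicits.

(* Main.v *)
Require Import Defs.
From HB Require Import structures.
From mathcomp Require Import all_boot all_order all_algebra.
From mathcomp Require Import all_classical all_reals all_analysis.
From mathcomp Require Import measurable_realfun.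
From mathcomp Require Import ring lra zify.
Import Order.TTheory GRing.Theory Num.Theory.
Import numFieldNormedType.Exports.

(** Why the theorem is true.

    Let [r(n, k)] be the number of rooted trees on [n] labels with [k] improper
    edges, and [A] the exponential generating function of the polynomials
    [sum_k r(n, k) y^k].  Look at the smallest label.  If it is not the root,
    the branch of the root containing it hangs from an improper edge; cutting
    this edge leaves two arbitrary trees.  If it is the root, all its edges are
    proper, and cutting the branch of a second fixed label leaves an arbitrary
    tree and a tree of the same kind.  Hence [A' = B + y A A'] and [B' = A' B],
    where [B] counts the trees rooted at their smallest label
    ([total_weightE]).

    The solution of this system also satisfies a linear equation.  With
    [D = (1 - (1 + y) x) d/dx - y^2 d/dy] one has [D A = 1] and [D B = B]: the
    series defined by these two equations solve the system, because the defect
    [e] of each identity satisfies [D e = c e] and [e(0) = 0] ([tree_polyS],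
    [min_tree_polyS]).  In coefficients,
    [r(n + 1, k) = n r(n, k) + (n + k - 1) r(n, k - 1)] ([tree_sumS]).  Counting
    the ways to apply this step [m] times yields Cayley's formula
    ([tree_sum_Cayley]), so that with [e_n = (1 + 1/n)^n] the recurrence reads
    [n e_n E h(X_(n+1)) = E (n h(X_n) + (n + X_n) h(X_n + 1))]
    ([tree_expectS]).

    The factor [X_n] on the right makes every moment explicit: [h = 1] and
    [h k = k] give the mean [n e_n - 2 n] and the variance in closed form, and
    their expansions follow from that of [e_n].  For [h k = (k - mu (n + 1))^p]
    one obtains the centred moment of order [p + 1] at [n] in terms of those of
    order at most [p] at [n] and [n + 1] ([cmomentS]).  All these sequences have
    asymptotic expansions in powers of [1/n], and a difference of consecutive
    terms loses one order.  The induction thus shows that the centred moment of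
    order [p] has size at most [n^(p/2)], with leading coefficients satisfying
    [m_(2q+2) = (2 q + 1) sigma^2 m_(2q)]: these are the moments of the normal
    law ([cmoment_expands]).

    It remains to pass from moments to distribution functions
    ([moment_method]).  By Taylor's formula the convergence of moments extends
    to cosines of any frequency, hence to trigonometric polynomials.  A steep
    odd polynomial of a slow sine is a trigonometric polynomial close to a step
    function over a long interval, and the second moment controls what happens
    outside of it. *)

Set Implicit Arguments.
Unset Strict Implicit.
Unset Printing Implicit Defensive.

(** * Trees as parent functions *)

Section ParentFunctions.

Variable n : nat.
Implicit Types (S A B : {set 'I_n}) (f g : {ffun 'I_n -> 'I_n}).
Implicit Types (r c u v w m : 'I_n).

(** The value at the root is the root itself; the identity outside [S] makes the
    function encoding a tree on [S] unique. *)
Definition ptree S r f :=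
  [&& r \in S, f r == r, [forall v, (v \notin S) ==> (f v == v)]
    & [forall v in S, fconnect f v r]].

(** The fixed points of [f] are the root and the vertices outside the tree; any
    other [v] stands for the edge above it.  As [f v] does not lie below [v],
    the inequality [w <= f v] is strict. *)
Definition improper_count f : nat :=
  #|[set v | (f v != v) && [exists w, fconnect f w v && (w <= f v)%N]]%SET|.

Lemma fconnect_step f w v :
  fconnect f w v = (w == v) || fconnect f (f w) v.
Proof.
apply/idP/idP => [|/predU1P[->//|]]; last exact: connect_trans (fconnect1 f w).
move=> /iter_findex; case: (findex f w v) => [|k] /=; first by move=> ->; rewrite eqxx.
by rewrite -iterS iterSr => <-; rewrite fconnect_iter orbT.
Qed.

Lemma fconnect_fixed f r v : f r = r -> fconnect f r v = (r == v).
Proof.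
move=> fr; apply/idP/eqP => [/iter_findex|->//].
by elim: (findex f r v) => [//|k IHk]; rewrite iterSr fr.
Qed.

Section Ptree.
Variables (S : {set 'I_n}) (r : 'I_n) (f : {ffun 'I_n -> 'I_n}).
Hypothesis tf : ptree S r f.

Lemma ptree_root_in : r \in S. Proof. by case/and4P: tf. Qed.

Lemma ptree_root : f r = r. Proof. by case/and4P: tf => _ /eqP. Qed.

Lemma ptree_out v : v \notin S -> f v = v.
Proof. by case/and4P: tf => _ _ /forallP/(_ v)/implyP h _ /h/eqP. Qed.

Lemma ptree_connect v : v \in S -> fconnect f v r.
Proof. by case/and4P: tf => _ _ _ /forallP/(_ v)/implyP. Qed.

Lemma ptree_closed v : v \in S -> f v \in S.
Proof.
move=> vS; apply/negPn/negP => fvS; have := ptree_connect vS.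
rewrite fconnect_step (fconnect_fixed _ (ptree_out fvS)) => /orP[] /eqP E.
  by move: fvS; rewrite E ptree_root ptree_root_in.
by rewrite E ptree_root_in in fvS.
Qed.

Lemma ptree_ind (P : 'I_n -> Prop) :
  P r -> (forall v, v \in S -> v != r -> P (f v) -> P v) ->
  forall v, v \in S -> P v.
Proof.
move=> Pr IH v vS; have /iter_findex := ptree_connect vS.
move: (findex f v r) => k; elim: k v vS => [v _ /= ->//|k IHk v vS].
rewrite iterSr => E; have [->//|vr] := eqVneq v r.
by apply: IH => //; apply: IHk => //; exact: ptree_closed.
Qed.

Lemma fconnect_in v w : v \in S -> fconnect f w v -> w \in S.
Proof.
move=> vS; apply: contraTT => wS.
by rewrite (fconnect_fixed _ (ptree_out wS)); apply: contraNneq wS => ->.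
Qed.

(** A cycle could be run through for ever, but the iterates stop at the root. *)
Lemma ptree_acyclic v : v \in S -> v != r -> ~~ fconnect f (f v) v.
Proof.
move=> vS vr; apply/negP => /iter_findex; rewrite -iterSr.
set k := findex _ _ _ => E; have /iter_findex := ptree_connect vS.
set l := findex _ _ _ => El.
have Ek j : iter (j * k.+1) f v = v.
  by elim: j => [//|j IHj]; rewrite mulSn iterD IHj.
have Er j : iter j f r = r by elim: j => [//|j /= ->]; exact: ptree_root.
move: vr; rewrite -(Ek l).
have -> : (l * k.+1 = (l * k.+1 - l) + l)%N by rewrite subnK // leq_pmulr.
by rewrite iterD El Er eqxx.
Qed.

Lemma ptree_neq v : v \in S -> v != r -> f v != v.
Proof. by move=> vS vr; apply: contra (ptree_acyclic vS vr) => /eqP {1}->. Qed.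

End Ptree.

(** Joins a tree on [A] with root [c] to a tree off [A] by an edge from [r] to
    [c]. *)
Definition glue A r c (f12 : {ffun 'I_n -> 'I_n} * {ffun 'I_n -> 'I_n}) :
    {ffun 'I_n -> 'I_n} :=
  [ffun v => if v == c then r else if v \in A then f12.1 v else f12.2 v].

(** Undoes [glue] when [A] is the branch at [c] and [B] the rest of the tree. *)
Definition cut A B c f : {ffun 'I_n -> 'I_n} * {ffun 'I_n -> 'I_n} :=
  ([ffun v => if (v \in A) && (v != c) then f v else v],
   [ffun v => if v \in B then f v else v]).

Section Glue.
Variables (S A : {set 'I_n}) (r c : 'I_n) (f1 f2 : {ffun 'I_n -> 'I_n}).
Hypotheses (AS : A \subset S) (rA : r \notin A).
Hypotheses (t1 : ptree A c f1) (t2 : ptree (S :\: A) r f2).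
Let f : {ffun 'I_n -> 'I_n} := glue A r c (f1, f2).

Let cA : c \in A. Proof. exact: ptree_root_in t1. Qed.
Let rS : r \in S. Proof. by have := ptree_root_in t2; rewrite inE => /andP[]. Qed.
Let rc : r != c. Proof. by apply: contraNneq rA => ->. Qed.

Let fc : f c = r. Proof. by rewrite ffunE eqxx. Qed.
Let fA v : v \in A -> v != c -> f v = f1 v.
Proof. by move=> vA /negPf vc; rewrite ffunE vc vA. Qed.
Let fB v : v \notin A -> f v = f2 v.
Proof.
move=> vA; rewrite ffunE (negPf vA); case: eqP => // E.
by rewrite E cA in vA.
Qed.
Let fr : f r = r. Proof. by rewrite fB // (ptree_root t2). Qed.

Let fconnect_glue_root v : v \in A -> fconnect f v c.
Proof.
move: v; apply: (ptree_ind t1) => [//|v vA vc IH].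
by rewrite fconnect_step fA // IH orbT.
Qed.

Lemma fconnect_glue_l w v : v \in A -> fconnect f w v = fconnect f1 w v.
Proof.
move=> vA; have [wA|wA] := boolP (w \in A); last first.
  rewrite (fconnect_fixed _ (ptree_out t1 wA)).
  apply/idP/eqP => [|->//]; move/iter_findex => E; exfalso.
  suff : v \notin A by rewrite vA.
  rewrite -E; elim: (findex _ _ _) => [//|k IHk] /=.
  rewrite fB //; have [kS|kS] := boolP (iter k f w \in S :\: A).
    by have := ptree_closed t2 kS; rewrite inE => /andP[].
  by rewrite (ptree_out t2 kS).
move: w wA; apply: (ptree_ind t1) => [|w wA wc IH].
  rewrite fconnect_step fc (fconnect_fixed _ fr).
  rewrite (fconnect_fixed _ (ptree_root t1)).
  have /negPf-> : r != v by apply: contraNneq rA => ->.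
  by rewrite orbF.
by rewrite fconnect_step fA // IH [RHS]fconnect_step.
Qed.

(** Climbing out of [A] ends at [r] at once, so no other vertex off [A] gains a
    descendant. *)
Lemma fconnect_glue_r w v :
  v \notin A -> v != r -> fconnect f w v = fconnect f2 w v.
Proof.
move=> vA vr; have [wA|wA] := boolP (w \in A).
  have wB : w \notin S :\: A by rewrite inE wA.
  rewrite (fconnect_fixed _ (ptree_out t2 wB)).
  have /negPf-> : w != v by apply: contraNneq vA => <-.
  move: w wA {wB}; apply: (ptree_ind t1) => [|w wA wc IH].
    rewrite fconnect_step fc (fconnect_fixed _ fr) (eq_sym r).
    by rewrite (negPf vr) orbF; apply: contraNF vA => /eqP <-.
  rewrite fconnect_step fA // IH orbF.
  by apply: contraNF vA => /eqP <-.
have fk k : iter k f w = iter k f2 w /\ iter k f w \notin A.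
  elim: k => [//|k /= [IH1 IH2]]; rewrite fB // -IH1; split=> //.
  have [kS|kS] := boolP (iter k f w \in S :\: A).
    by have := ptree_closed t2 kS; rewrite inE => /andP[].
  by rewrite (ptree_out t2 kS).
apply/idP/idP => /iter_findex <-.
  by rewrite (fk _).1 fconnect_iter.
by rewrite -(fk _).1 fconnect_iter.
Qed.

Lemma glue_ptree : ptree S r f.
Proof.
rewrite /ptree rS fr eqxx /=; apply/andP; split; apply/forallP => v; apply/implyP.
  move=> vS; have vA : v \notin A by apply: contra vS; exact: (fintype.subsetP AS).
  by rewrite fB // (ptree_out t2) // inE (negPf vS) andbF.
move=> vS; have [vA|vA] := boolP (v \in A).
  apply: (connect_trans (fconnect_glue_root vA)).
  by rewrite fconnect_step fc connect0 orbT.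
have {vS} : v \in S :\: A by rewrite inE vA.
move: v {vA}; apply: (ptree_ind t2) => [|v]; first exact: connect0.
by rewrite !inE => /andP[vA vS] _ IH; rewrite fconnect_step fB // IH orbT.
Qed.

Lemma glue_child : f c = r. Proof. exact: fc. Qed.

Lemma glue_subtree : [set w | fconnect f w c]%SET = A.
Proof.
apply/setP => w; rewrite inE fconnect_glue_l //.
apply/idP/idP => [|wA]; first exact: fconnect_in t1 _ _ cA.
exact: ptree_connect t1 _ wA.
Qed.

Lemma cut_glue : cut A (S :\: A) c f = (f1, f2).
Proof.
congr pair; apply/ffunP => v; rewrite ffunE.
  have [vA|vA] /= := boolP (v \in A); last by rewrite (ptree_out t1 vA).
  by have [->|vc] /= := eqVneq v c; [rewrite (ptree_root t1)|rewrite fA].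
case: ifP => [|/negbT vB]; last by rewrite (ptree_out t2 vB).
by rewrite inE => /andP[vA _]; rewrite fB.
Qed.

(** Properness of an edge depends on the descendants of its lower end.  Gluing
    changes the descendants of [r] only, and no edge has the root as lower end;
    so the new edge alone has to be examined. *)
Lemma improper_count_glue : improper_count f =
  (improper_count f1 + improper_count f2 + [exists w in A, (w <= r)%N])%N.
Proof.
have cB : c \notin S :\: A by rewrite inE cA.
pose I (g : {ffun 'I_n -> 'I_n}) :=
  [set v | (g v != v) && [exists w, fconnect g w v && (w <= g v)%N]]%SET.
have I1A : I f1 \subset A :\ c.
  apply/fintype.subsetP => v; rewrite !inE => /andP[+ _]; apply: contraR.
  rewrite negb_and negbK => /orP[/eqP->|vA]; first by rewrite (ptree_root t1).
  by rewrite (ptree_out t1 vA).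
have I2A v : v \in I f2 -> (v \notin A) && (v != r).
  rewrite !inE => /andP[+ _]; apply: contraR; rewrite negb_and !negbK.
  case/orP => [vA|/eqP->]; last by rewrite (ptree_root t2).
  by rewrite (ptree_out t2) // inE vA.
(* gluing adds the edge into [c], provided that it is improper *)
have IfE : I f = (I f1 :|: I f2) :|:
    (if [exists w in A, (w <= r)%N] then [set c]%SET else finset.set0).
  apply/setP => v; rewrite !inE.
  have [->|vc] := eqVneq v c.
    rewrite fc rc /= (ptree_root t1) (ptree_out t2 cB) eqxx /=.
    transitivity [exists w in A, (w <= r)%N]; last by case: ifP; rewrite !inE ?eqxx.
    apply: eq_existsb => w; congr (_ && _).
    by rewrite -[in RHS]glue_subtree inE.
  have -> : v \in (if [exists w in A, (w <= r)%N] then [set c]%SET else finset.set0) = false.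
    by case: ifP; rewrite !inE ?(negPf vc).
  rewrite orbF; have [vA|vA] := boolP (v \in A).
    rewrite fA // (ptree_out t2) ?inE ?vA // eqxx orbF; congr (_ && _).
    by apply: eq_existsb => w; rewrite fconnect_glue_l.
  rewrite fB // (ptree_out t1 vA) eqxx /=.
  have [->|vr] := eqVneq v r; first by rewrite (ptree_root t2) eqxx.
  by congr (_ && _); apply: eq_existsb => w; rewrite fconnect_glue_r.
rewrite /improper_count -/(I f) -/(I f1) -/(I f2) IfE cardsU.
have -> : (I f1 :|: I f2) :&:
    (if [exists w in A, (w <= r)%N] then [set c]%SET else finset.set0) = finset.set0.
  case: ifP => _; last by rewrite finset.setI0.
  apply/setP => v; rewrite finset.in_setI finset.in_setU !finset.in_set1 finset.in_set0.
  have [->|_] := eqVneq v c; last by rewrite andbF.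
  rewrite andbT; apply/negbTE; rewrite negb_or.
  apply/andP; split.
    by apply: contraTN isT => /(fintype.subsetP I1A); rewrite !inE eqxx.
  by apply: contraTN cA => h; case/andP: (I2A _ h).
rewrite cards0 subn0 cardsU.
have -> : I f1 :&: I f2 = finset.set0.
  apply/setP => v; rewrite finset.in_setI finset.in_set0; apply/negbTE.
  apply/negP => /andP[/(fintype.subsetP I1A) h1 h2].
  by case/andP: (I2A _ h2) => vA; move: h1; rewrite !inE (negPf vA) andbF.
rewrite cards0 subn0; congr (_ + _)%N.
by case: ifP; rewrite ?cards1 ?cards0.
Qed.

End Glue.

Section Cut.
Variables (S : {set 'I_n}) (r c : 'I_n) (f : {ffun 'I_n -> 'I_n}).
Hypotheses (tf : ptree S r f) (cr : c != r) (fcr : f c = r) (cS : c \in S).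
Let A := [set w | fconnect f w c]%SET.

Lemma cut_root_out : r \notin A.
Proof. by rewrite inE (fconnect_fixed _ (ptree_root tf)) eq_sym. Qed.

Lemma cut_sub : A \subset S.
Proof. by apply/fintype.subsetP => w; rewrite inE; exact: (fconnect_in tf). Qed.

Let closedB v : v \in S :\: A -> f v \in S :\: A.
Proof.
rewrite !inE => /andP[vA vS]; rewrite (ptree_closed tf vS) andbT.
by apply: contra vA => h; rewrite fconnect_step h orbT.
Qed.

Lemma cut_ptree_l : ptree A c (cut A (S :\: A) c f).1.
Proof.
set f1 := _.1.
have cA : c \in A by rewrite inE connect0.
rewrite /ptree cA ffunE eqxx andbF eqxx /=.
apply/andP; split; apply/forallP => v; apply/implyP.
  by move=> vA; rewrite ffunE (negPf vA).
rewrite inE => /iter_findex; move: (findex _ _ _) => k; elim: k v => [v /= ->|k IHk v].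
  exact: connect0.
rewrite iterSr => E; have [->|vc] := eqVneq v c; first exact: connect0.
rewrite fconnect_step; suff -> : f1 v = f v by rewrite IHk ?orbT.
by rewrite ffunE vc inE -E -iterSr fconnect_iter.
Qed.

Lemma cut_ptree_r : ptree (S :\: A) r (cut A (S :\: A) c f).2.
Proof.
set f2 := _.2.
have rB : r \in S :\: A by rewrite inE cut_root_out (ptree_root_in tf).
rewrite /ptree rB ffunE rB (ptree_root tf) eqxx /=.
apply/andP; split; apply/forallP => v; apply/implyP.
  by move=> vA; rewrite ffunE (negPf vA).
move=> vB; have /iter_findex : fconnect f v r.
  by apply: (ptree_connect tf); move: vB; rewrite inE => /andP[].
move: (findex _ _ _) => k; elim: k v vB => [v _ /= ->|k IHk v vB]; first exact: connect0.
rewrite iterSr => E; rewrite fconnect_step; apply/orP; right.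
have -> : f2 v = f v by rewrite ffunE vB.
by apply: IHk => //; exact: closedB.
Qed.

Lemma glue_cut : glue A r c (cut A (S :\: A) c f) = f.
Proof.
apply/ffunP => v; rewrite ffunE.
have [->//|vc] := eqVneq v c; rewrite !ffunE vc andbT.
have [//|vA] := boolP (v \in A).
have [//|] := boolP (v \in S :\: A).
by rewrite finset.in_setD vA => vS; rewrite (ptree_out tf vS).
Qed.

End Cut.

Lemma cut_ptree S A r c f f1 f2 : ptree S r f -> c != r ->
    A = [set w | fconnect f w c]%SET -> cut A (S :\: A) c f = (f1, f2) ->
  ptree A c f1 /\ ptree (S :\: A) r f2.
Proof.
move=> tf cr AE E; have := cut_ptree_l S c f; have := cut_ptree_r tf cr.
by rewrite -AE E.
Qed.

(** The child in question is the last vertex before the root on the way up from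
    [m]. *)
Lemma ptree_child S r f m : ptree S r f -> m \in S -> m != r ->
  exists2 c, [&& f c == r, c != r & fconnect f m c] &
    forall c', [&& f c' == r, c' != r & fconnect f m c'] -> c' = c.
Proof.
move=> tf mS mr.
suff [c Hc] : exists c, [&& f c == r, c != r & fconnect f m c].
  exists c => // c' /and3P[/eqP fc' c'r mc'].
  case/and3P: Hc => /eqP fc cr mc.
  suff H a b : f a = r -> f b = r -> a != r -> b != r ->
      fconnect f m a -> fconnect f m b -> (findex f m a <= findex f m b)%N -> b = a.
    by case/orP: (leq_total (findex f m c) (findex f m c')) => h;
      [apply: H h|apply/esym; apply: H h].
  move=> fa fb ar br /iter_findex Ea /iter_findex Eb /subnK E.
  move: Eb; rewrite -E iterD Ea; case: (_ - _)%N => [//|k].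
  rewrite iterSr fa => Eb; move: br; rewrite -Eb.
  suff -> : iter k f r = r by rewrite eqxx.
  by elim: k {Eb} => [//|k /= ->]; exact: ptree_root tf.
move: mr; move: m mS; apply: (ptree_ind tf); first by rewrite eqxx.
move=> m mS mr IH _; have [fm|/IH[c /and3P[fc cr mc]]] := eqVneq (f m) r.
  by exists m; rewrite fm eqxx mr connect0.
by exists c; rewrite fc cr fconnect_step mc orbT.
Qed.

End ParentFunctions.

(** * Generating functions of the number of improper edges *)

Section TreeWeights.

Variables (n : nat) (K : comNzRingType) (y : K).
Implicit Types (S A B : {set 'I_n}) (f g : {ffun 'I_n -> 'I_n}).
Implicit Types (r c u v w m : 'I_n).

Local Open Scope ring_scope.

Definition tree_weight S r : K := \sum_(f | ptree S r f) y ^+ improper_count f.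

Definition total_weight S : K := \sum_(r in S) tree_weight S r.

(** Cutting the edge from the root to the branch that contains [m] is a bijection
    onto the pairs of trees on complementary sets. *)
Lemma tree_weight_cut S r m : m \in S -> m != r ->
  tree_weight S r =
  \sum_(A : {set 'I_n} | [&& m \in A, r \notin A & A \subset S])
     y ^+ [exists w in A, (w <= r)%N] * total_weight A * tree_weight (S :\: A) r.
Proof.
move=> mS mr.
pose Q f c := [&& f c == r, c != r & fconnect f m c].
pose child f := odflt r [pick c | Q f c].
have childQ f : ptree S r f -> Q f (child f).
  move=> tf; have [c Qc _] := ptree_child tf mS mr.
  by rewrite /child; case: pickP => [//|/(_ c)]; rewrite [Q f c]Qc.
have childE f c : ptree S r f -> Q f c -> child f = c.
  move=> tf Qc; have [c' _ H] := ptree_child tf mS mr.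
  by rewrite (H _ (childQ _ tf)) (H _ Qc).
pose sub f c := [set w | fconnect f w c]%SET.
pose p f := (sub f (child f), child f).
pose C (Ac : {set 'I_n} * 'I_n) :=
  [&& m \in Ac.1, r \notin Ac.1 & Ac.1 \subset S] && (Ac.2 \in Ac.1).
have CP f : ptree S r f -> C (p f).
  move=> tf; case/and3P: (childQ _ tf) => /eqP fc cr mc.
  have cS : child f \in S.
    by apply: contraNT cr => /(ptree_out tf) <-; rewrite fc.
  rewrite /C /= !inE mc connect0 andbT /=.
  rewrite (cut_sub tf cS) andbT.
  by have := cut_root_out tf cr; rewrite inE.
rewrite /tree_weight (partition_big p C) //.
under [RHS]eq_bigr => A _ do rewrite /total_weight [_ * \sum_(_ in A) _]mulr_sumr mulr_suml.
rewrite [RHS]pair_big_dep /=.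
apply: eq_bigr => -[A c] /andP[/and3P[/= mA rA AS] /= cA].
rewrite (reindex_onto (glue A r c) (cut A (S :\: A) c)) /=; last first.
  move=> f /andP[tf /eqP[EA Ec]].
  case/and3P: (childQ _ tf) => /eqP; rewrite Ec => fc cr mc.
  have EA' : A = [set w | fconnect f w c]%SET by rewrite -EA /sub Ec.
  by rewrite EA'; apply: glue_cut.
rewrite /tree_weight -mulrA big_distrl big_distrr /=.
under [RHS]eq_bigr => f1 _ do rewrite !big_distrr /=.
rewrite [RHS]pair_big_dep /=.
apply: eq_big => [[f1 f2]|[f1 f2]] /=.
  apply/idP/idP => [/andP[/andP[tf /eqP[EA Ec]] /eqP E]|/andP[t1 t2]].
    case/and3P: (childQ _ tf) => /eqP; rewrite Ec => fc cr mc.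
    have EA' : A = [set w | fconnect (glue A r c (f1, f2)) w c]%SET.
      by rewrite -[LHS]EA /sub Ec.
    by have [-> ->] := cut_ptree tf cr EA' E.
  rewrite (cut_glue t1 t2) eqxx andbT.
  have tg := glue_ptree AS rA t1 t2.
  rewrite tg /= xpair_eqE.
  have -> : child (glue A r c (f1, f2)) = c.
    apply: childE => //; rewrite /Q (glue_child A r c f1 f2) eqxx /=.
    have cr : c != r by apply: contraNneq rA => <-.
    rewrite cr /=.
    have := glue_subtree rA t1 t2.
    by move=> /finset.setP/(_ m); rewrite mA inE.
  by rewrite eqxx andbT; apply/eqP; exact: (glue_subtree rA t1 t2).
move=> /andP[/andP[tf /eqP[EA Ec]] /eqP E].
have [t1 t2] : ptree A c f1 /\ ptree (S :\: A) r f2.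
  case/and3P: (childQ _ tf) => /eqP; rewrite Ec => fc cr mc.
  have EA' : A = [set w | fconnect (glue A r c (f1, f2)) w c]%SET.
    by rewrite -[LHS]EA /sub Ec.
  exact: cut_ptree tf cr EA' E.
by rewrite (improper_count_glue rA t1 t2) !exprD mulrC.
Qed.

Lemma total_weight0 : total_weight finset.set0 = 0.
Proof. by rewrite /total_weight big1 // => r; rewrite inE. Qed.

Lemma tree_weight1 r : tree_weight [set r]%SET r = 1.
Proof.
rewrite /tree_weight (big_pred1 [ffun v => v]) => [|f] /=.
  rewrite /improper_count (_ : [set _ | _]%SET = finset.set0) ?cards0 //.
  by apply/finset.setP => v; rewrite !inE ffunE eqxx.
apply/idP/eqP => [tf|->].
  apply/ffunP => v; rewrite ffunE.
  have [->|vr] := eqVneq v r; first exact: ptree_root tf.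
  by rewrite (ptree_out tf) // inE.
rewrite /ptree inE ffunE !eqxx /=; apply/andP; split; apply/forallP => v.
  by rewrite ffunE eqxx implybT.
by apply/implyP; rewrite inE => /eqP->; exact: connect0.
Qed.

Lemma sum_subsets_card (U : {set 'I_n}) m k (F : nat -> K) :
  m \in U -> #|U| = k.+1 ->
  \sum_(A : {set 'I_n} | (m \in A) && (A \subset U)) F #|A| =
  \sum_(i < k.+1) F i.+1 *+ 'C(k, i).
Proof.
move=> mU Uk.
have Uk' : #|U :\ m| = k by apply/eqP; rewrite -eqSS -Uk (cardsD1 m U) mU.
transitivity (\sum_(A : {set 'I_n} | A \subset U :\ m) F #|A|.+1).
  rewrite (reindex_onto (fun A => m |: A)%SET (fun A => A :\ m)%SET) /=; last first.
    by move=> A /andP[mA _]; rewrite finset.setD1K.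
  apply: eq_big => [A|A] /=.
    rewrite !inE eqxx /= finset.subUset finset.sub1set mU /=.
    apply/andP/idP => [[AU /eqP <-]|].
      rewrite finset.setDUl finset.setDv finset.set0U.
      exact: finset.setSD.
    rewrite finset.subsetD1 => /andP[AU mA]; split=> //.
    by rewrite finset.setU1K.
  move=> /andP[_ /eqP E].
  by rewrite cardsU1 -{1}E !inE eqxx.
rewrite (partition_big (fun A : {set 'I_n} => inord #|A| : 'I_k.+1) xpredT) //=.
apply: eq_bigr => i _.
rewrite (eq_bigr (fun=> F i.+1)); last first.
  move=> A /andP[AU /eqP <-]; rewrite inordK // ltnS -Uk'.
  exact: subset_leq_card.
rewrite sumr_const; congr (_ *+ _).
have := cards_draws (U :\ m)%SET i; rewrite Uk' => <-; apply: eq_card => A; rewrite !inE.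
rewrite unfold_in /=; have [AU|//] := boolP (A \subset U :\ m).
by rewrite -val_eqE /= inordK // ltnS -Uk'; exact: subset_leq_card.
Qed.

(** The hypotheses are the coefficients of the identities [A' = B + y A A'] and
    [B' = A' B] between exponential generating functions.  Let [m] be the smallest
    label of [S].  If the root is [m], cut the branch of any second vertex, which
    hangs from a proper edge; otherwise cut the branch of [m], which hangs from an
    improper one.  The series [B] counts the trees rooted at their smallest label,
    with [b k] belonging to [k + 1] vertices. *)
Theorem total_weightE (a b : nat -> K) :
    a 0%N = 0 -> b 0%N = 1 ->
    (forall k, a k.+1 =
       b k + y * \sum_(i < k.+1) (a i.+1 * a (k - i)%N) *+ 'C(k, i)) ->
    (forall k, b k.+1 = \sum_(i < k.+1) (a i.+1 * b (k - i)%N) *+ 'C(k, i)) ->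
  forall S, total_weight S = a #|S|.
Proof.
move=> a0 b0 aS bS S0.
suff H k : forall S, (#|S| < k)%N -> total_weight S = a #|S| /\
    (forall r, r \in S -> (forall v, v \in S -> (r <= v)%N) ->
      tree_weight S r = b #|S|.-1).
  by have [] := H #|S0|.+1 S0 (ltnSn _).
elim: k => // k IHk S; rewrite ltnS => Sk.
have IHmin r : r \in S -> (forall v, v \in S -> (r <= v)%N) ->
    tree_weight S r = b #|S|.-1.
  move=> rS rmin; have Sr : #|S| = #|S :\ r|.+1 by rewrite (cardsD1 r S) rS.
  have [/eqP|[m mSr]] := finset.set_0Vmem (S :\ r)%SET.
    rewrite finset.setD_eq0 finset.subset1 => /orP[]/eqP SE; last by rewrite SE inE in rS.
    by rewrite SE cards1 tree_weight1 b0.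
  have [mr mS] := finset.setD1P mSr.
  rewrite (tree_weight_cut mS mr) Sr /=.
  have [j Sj] : {j | #|S :\ r| = j.+1}.
    by exists #|S :\ r|.-1; rewrite prednK // card_gt0; apply/finset.set0Pn; exists m.
  rewrite Sj bS -(sum_subsets_card (fun l => a l * b (j.+1 - l)%N) mSr Sj).
  apply: eq_big => [A|A /and3P[mA rA AS]].
    by rewrite finset.subsetD1; case: (m \in A) => //=; rewrite andbC.
  have /negPf-> : ~~ [exists w in A, (w <= r)%N].
    apply/negP => /existsP[w /andP[wA wr]].
    have wS := fintype.subsetP AS _ wA.
    move: rA; suff -> : r = w by rewrite wA.
    by apply/val_inj/eqP; rewrite eqn_leq wr rmin.
  have cA : (#|S :\: A| = j.+2 - #|A|)%N by rewrite cardsDS // Sr Sj.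
  have Ale : (#|A| <= j.+1)%N.
    rewrite -Sj; apply: subset_leq_card; rewrite finset.subsetD1 AS rA //.
  rewrite expr0 mul1r.
  have Ak : (#|A| < k)%N by rewrite (leq_trans _ Sk) // Sr Sj ltnS.
  have [-> _] := IHk A Ak.
  have rB : r \in S :\: A by rewrite inE rA.
  have Bk : (#|S :\: A| < k)%N.
    rewrite cA (leq_trans _ Sk) // Sr Sj ltn_subrL /= card_gt0.
    by rewrite andbT; apply/finset.set0Pn; exists m.
  have [_ ->] := IHk (S :\: A)%SET Bk; rewrite ?cA ?(subSn Ale) //.
  by move=> v /finset.setDP[vS _]; exact: rmin.
split=> //.
have [->|[v0 v0S]] := finset.set_0Vmem S; first by rewrite total_weight0 cards0 a0.
have [m mS mmin] : exists2 m, m \in S & forall v, v \in S -> (m <= v)%N.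
  by case: (arg_minnP (fun v : 'I_n => v : nat) v0S) => m mS mmin; exists m.
rewrite /total_weight (big_setD1 m) //= (IHmin _ mS mmin).
have [j Sj] : {j | #|S| = j.+1}.
  by exists #|S|.-1; rewrite prednK // card_gt0; apply/finset.set0Pn; exists m.
rewrite Sj aS /=; congr (_ + _).
rewrite -(sum_subsets_card (fun l => a l * a (j.+1 - l)%N) mS Sj) mulr_sumr.
rewrite (eq_bigr (fun r => \sum_(A : {set 'I_n} | [&& m \in A, r \notin A & A \subset S])
     y * total_weight A * tree_weight (S :\: A) r)); last first.
  move=> r /finset.setD1P[rm rS]; rewrite (tree_weight_cut mS) 1?eq_sym //.
  apply: eq_bigr => A /and3P[mA rA AS].
  suff -> : [exists w in A, (w <= r)%N] by rewrite expr1.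
  by apply/existsP; exists m; rewrite mA mmin.
rewrite (exchange_big_dep (fun A : {set 'I_n} => (m \in A) && (A \subset S))) /=; last first.
  by move=> r A _ /and3P[-> _ ->].
apply: eq_bigr => A /andP[mA AS].
transitivity (y * (total_weight A * total_weight (S :\: A))).
  rewrite mulrA /total_weight [RHS]mulr_sumr; apply: eq_bigl => r.
  rewrite !inE mA AS andbT /=; have [->|_] /= := eqVneq r m.
    by rewrite mA.
  by rewrite andbC.
(* [A = S] leaves no room for the root; it is matched by [a 0 = 0] *)
have [->|AS'] := eqVneq A S.
  by rewrite finset.setDv total_weight0 Sj subnn a0 !mulr0.
have ltA : (#|A| < #|S|)%N by apply: proper_card; rewrite finset.properEneq AS'.
have A0 : (0 < #|A|)%N by rewrite card_gt0; apply/finset.set0Pn; exists m.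
have [-> _] := IHk A (leq_trans ltA Sk).
have cA : (#|S :\: A| = j.+1 - #|A|)%N by rewrite cardsDS // Sj.
have [|-> _] := IHk (S :\: A); last by rewrite cA.
by rewrite cA (leq_trans _ Sk) // Sj ltn_subrL A0.
Qed.

End TreeWeights.

(** * Tree graphs and parent functions *)

Section TreeGraphs.

Variable n : nat.
Implicit Types (E : graph n) (S : {set 'I_n}) (f : {ffun 'I_n -> 'I_n}).
Implicit Types (r u v w : 'I_n).

Definition parent_graph f : graph n :=
  [set xy | (xy.1 != xy.2) && ((f xy.1 == xy.2) || (f xy.2 == xy.1))]%SET.

Lemma adj_parent_graph f x y :
  adj (parent_graph f) x y = (x != y) && ((f x == y) || (f y == x)).
Proof. by rewrite /adj inE. Qed.

Lemma parent_graph_simple f : simple_graph (parent_graph f).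
Proof.
by split=> [x y|x]; rewrite !adj_parent_graph ?eqxx // eq_sym orbC.
Qed.

Section ParentGraph.
Variables (r : 'I_n) (f : {ffun 'I_n -> 'I_n}).
Hypothesis tf : ptree finset.setT r f.
Let E := parent_graph f.

Let adj_f v : v != r -> adj E v (f v).
Proof.
by move=> vr; rewrite adj_parent_graph eqxx /= andbT eq_sym (ptree_neq tf) ?finset.in_setT.
Qed.

Let connect_root v : connect (adj E) v r.
Proof.
have := finset.in_setT v; move: v; apply: (ptree_ind tf) => [|v _ vr IH].
  exact: connect0.
exact: connect_trans (connect1 (adj_f vr)) IH.
Qed.

Let adj_sym : symmetric (adj E). Proof. by case: (parent_graph_simple f). Qed.

Lemma parent_graph_connected : connected_graph E.
Proof.
move=> x y; apply: connect_trans (connect_root x) _.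
by rewrite (sym_connect_sym adj_sym).
Qed.

Let height v := #|[set w | fconnect f v w]%SET|.

Let heightS v : v != r -> (height (f v) < height v)%N.
Proof.
move=> vr; apply: proper_card; apply/properP; split.
  apply/fintype.subsetP => w; rewrite !inE => h.
  by rewrite fconnect_step h orbT.
exists v; first by rewrite inE connect0.
by rewrite inE; apply: (ptree_acyclic tf); rewrite ?finset.in_setT.
Qed.

(** The deepest vertex of a cycle would have two parents. *)
Lemma parent_graph_acyclic : acyclic_graph E.
Proof.
move=> c c2 cc; have [v0 v0c] : {v | v \in c}.
  by case: c c2 {cc} => // v c _; exists v; rewrite mem_head.
case: (arg_maxnP height v0c) => v vc vmax.
have [i c' Ec'] := rot_to vc.
have := cc; rewrite -(rot_ucycle i) Ec' => /andP[].
have : (2 < size (v :: c'))%N by rewrite -Ec' size_rot.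
have c'c x : x \in v :: c' -> x \in c by rewrite -Ec' mem_rot.
have adj_c x : x \in c -> adj E v x -> x = f v.
  move=> xc; rewrite adj_parent_graph => /andP[vx /orP[/eqP//|/eqP fx]].
  have xr : x != r by apply: contraNneq vx => xr; rewrite -fx xr (ptree_root tf).
  have hx : (height x <= height v)%N := vmax x xc.
  by have := heightS xr; rewrite fx ltnNge hx.
case: c' c'c {Ec'} => [|x [|z s]] // c'c _ /= /andP[vx].
rewrite rcons_path => /andP[_ /andP[_ lv]] /and3P[_ + _].
rewrite (adj_c x) //; last by rewrite c'c // !inE eqxx orbT.
rewrite -(adj_c (last z s)); last by rewrite adj_sym.
  by rewrite mem_last.
by rewrite c'c // 2!in_cons mem_last !orbT.
Qed.

Lemma parent_graph_tree : is_tree E.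
Proof.
split; [exact: parent_graph_simple|exact: parent_graph_connected|].
exact: parent_graph_acyclic.
Qed.

Let root_path v : exists q, [/\ path (adj E) r q, last r q = v, uniq (r :: q)
  & forall x, x \in r :: q -> fconnect f v x].
Proof.
have := finset.in_setT v; move: v; apply: (ptree_ind tf) => [|v _ vr].
  by exists [::]; split=> // x; rewrite inE => /eqP->; exact: connect0.
move=> [q [pq lq uq cq]]; exists (rcons q v); split.
- by rewrite rcons_path pq lq adj_sym adj_f.
- by rewrite last_rcons.
- rewrite -rcons_cons rcons_uniq uq andbT.
  by apply/negP => /cq; apply/negP/(ptree_acyclic tf); rewrite ?finset.in_setT.
- move=> x; rewrite -rcons_cons mem_rcons inE => /predU1P[->|/cq h].
    exact: connect0.
  by rewrite fconnect_step h orbT.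
Qed.

(** Each step of a simple path from the root goes to a child, as the parent of
    the current vertex has just been visited. *)
Lemma parent_parent_graph i j : parent (E, r) i j = (j != r) && (f j == i).
Proof.
have -> : parent (E, r) i j = `[< exists p : seq 'I_n,
    [/\ path (adj E) r (rcons p j), uniq (r :: rcons p j) & last r p = i] >] by [].
apply/asboolP/andP => [[p []]|[jr /eqP fj]]; last first.
  have [q [pq lq uq cq]] := root_path i.
  exists q; split=> //; first by rewrite rcons_path pq lq adj_sym -fj adj_f.
  rewrite -rcons_cons rcons_uniq uq andbT; apply/negP => /cq.
  by rewrite -fj; apply/negP/(ptree_acyclic tf); rewrite ?finset.in_setT.
elim/last_ind: p i j => [|p k IHp] i j.
  rewrite /= andbT adj_parent_graph (ptree_root tf) => /andP[/negPf rj].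
  by rewrite rj /= => fj _ <-; rewrite eq_sym rj.
rewrite rcons_path last_rcons -rcons_cons rcons_uniq => /andP[pk akj].
move=> /andP[jpk upk] ki.
have [_ /eqP fk] := IHp _ _ pk upk erefl.
move: akj; rewrite adj_parent_graph => /andP[kj].
case/orP => [/eqP fkj|/eqP fjk].
  by move: jpk; rewrite -fkj fk -rcons_cons mem_rcons inE mem_last orbT.
rewrite fjk ki eqxx; split=> //.
by apply: contraNneq jpk => ->; rewrite mem_head.
Qed.

Lemma subtree_parent_graph j : subtree (E, r) j = [set w | fconnect f w j]%SET.
Proof.
apply/finset.setP => w; rewrite !inE; apply/idP/idP.
  have /= <- := connect_rev (frel f) j w.
  apply: connect_sub => x y.
  by rewrite parent_parent_graph => /andP[_ h]; apply: connect1.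
move=> /iter_findex; move: (findex f w j) => k.
elim: k w => [w /= ->|k IHk w].
  exact: connect0.
rewrite iterSr => /IHk h.
have [wE|wr] := eqVneq w r; first by move: h; rewrite wE (ptree_root tf).
by apply: connect_trans h (connect1 _); rewrite parent_parent_graph wr eqxx.
Qed.

Lemma nb_improper_parent_graph : nb_improper (E, r) = improper_count f.
Proof.
rewrite /nb_improper /improper_count.
rewrite -[RHS](card_imset _ (_ : injective (fun v => (f v, v)))); last first.
  by move=> u v [].
congr #|pred_of_set _|; apply/finset.setP => -[i j].
rewrite !inE parent_parent_graph /=.
have jr : (j != r) = (f j != j).
  have [->|jr] := eqVneq j r; first by rewrite (ptree_root tf) eqxx.
  by rewrite (ptree_neq tf) ?finset.in_setT.
have improperE : ~~ proper_edge (E, r) i j =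
    [exists w, fconnect f w j && (w <= i)%N].
  rewrite /proper_edge negb_forall; apply: eq_existsb => w.
  by rewrite subtree_parent_graph inE negb_imply -leqNgt.
apply/andP/imsetP => [[/andP[j_r /eqP fj] im]|[v + [-> ->]]].
  by exists j; rewrite ?fj // inE -jr j_r fj -improperE im.
rewrite inE => /andP[fv im]; split; last first.
  rewrite /proper_edge negb_forall; have /existsP[w /andP[wv wfv]] := im.
  by apply/existsP; exists w; rewrite subtree_parent_graph inE negb_imply -leqNgt wv.
rewrite eqxx andbT; apply: contraNneq fv => ->.
by rewrite (ptree_root tf).
Qed.

End ParentGraph.

Lemma ptree_add S r f s v : ptree S r f -> s \in S -> v \notin S ->
  ptree (v |: S) r [ffun x => if x == v then s else f x].
Proof.
move=> tf sS vS; set g := [ffun x => _].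
have rS := ptree_root_in tf.
have gS w : w \in S -> g w = f w.
  by move=> wS; rewrite ffunE; case: eqP => // E; rewrite -E wS in vS.
have gr w : w \in S -> fconnect g w r.
  move: w; apply: (ptree_ind tf) => [|w wS wr IH]; first exact: connect0.
  by rewrite fconnect_step gS // IH orbT.
rewrite /ptree !inE rS orbT gS // (ptree_root tf) eqxx /=.
apply/andP; split; apply/forallP => w; apply/implyP; rewrite !inE.
  rewrite negb_or => /andP[wv wS]; rewrite ffunE (negPf wv).
  by rewrite (ptree_out tf).
case/predU1P => [->|]; last exact: gr.
by rewrite fconnect_step ffunE eqxx gr ?orbT.
Qed.

(** A tree that does not reach every vertex is extended along an edge leaving it,
    which exists by connectedness. *)
Lemma spanning_ptree E r : symmetric (adj E) -> connected_graph E ->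
  exists2 f, ptree finset.setT r f & parent_graph f \subset E.
Proof.
move=> Esym Econ.
suff H k : forall S f, (#|~: S| <= k)%N -> ptree S r f -> parent_graph f \subset E ->
    exists2 f, ptree finset.setT r f & parent_graph f \subset E.
  apply: (H _ [set r]%SET [ffun v => v]) (leqnn _) _ _.
    rewrite /ptree inE ffunE !eqxx /=; apply/andP; split; apply/forallP => v.
      by rewrite ffunE eqxx implybT.
    by apply/implyP; rewrite inE => /eqP->; exact: connect0.
  apply/fintype.subsetP => -[x y]; rewrite inE /= !ffunE (eq_sym y) orbb.
  by rewrite andNb.
elim: k => [|k IHk] S f.
  rewrite leqn0 cards_eq0 => /eqP ST tf sE; exists f => //.
  by rewrite -[finset.setT]finset.setC0 -ST finset.setCK.
move=> Sk tf sE.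
have [STE|ST] := eqVneq S finset.setT; first by exists f => //; rewrite -STE.
have [[s v] /= [sS vS sv]] : exists sv : 'I_n * 'I_n,
    [/\ sv.1 \in S, sv.2 \notin S & adj E sv.1 sv.2].
  apply: contrapT => noedge.
  have cl : fingraph.closed (adj E) (mem S).
    move=> x y xy; apply/idP/idP => [xS|yS]; apply/negPn/negP => h.
      by apply: noedge; exists (x, y).
    by apply: noedge; exists (y, x); split=> //=; rewrite Esym.
  move/eqP: ST; apply; apply/finset.setP => x; rewrite finset.in_setT.
  by rewrite -(closed_connect cl (Econ r x)) /= (ptree_root_in tf).
apply: (IHk (v |: S)%SET [ffun x => if x == v then s else f x]).
- rewrite -ltnS; apply: leq_trans Sk; apply: proper_card; apply/properP; split.
    by apply/fintype.subsetP => x; rewrite !inE negb_or => /andP[].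
  by exists v; rewrite !inE ?eqxx.
- exact: ptree_add.
apply/fintype.subsetP => -[x y]; rewrite inE /= !ffunE.
have [->|xv] := eqVneq x v.
  have [->|yv] := eqVneq y v; first by rewrite ?eqxx.
  case/andP => _ /orP[/eqP<-|]; first by have := sv; rewrite Esym.
  move=> /eqP fy; exfalso; move: vS; rewrite -fy => fyS.
  have [yS|yS] := boolP (y \in S); first by rewrite (ptree_closed tf yS) in fyS.
  by move: yv; rewrite -fy (ptree_out tf yS) eqxx.
have [->|yv] := eqVneq y v.
  case/andP => _ /orP[|/eqP<-//] /eqP fx; exfalso; move: vS; rewrite -fx => fxS.
  have [xS|xS] := boolP (x \in S); first by rewrite (ptree_closed tf xS) in fxS.
  by move: xv; rewrite -fx (ptree_out tf xS) eqxx.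
by move=> h; apply: (fintype.subsetP sE); rewrite inE.
Qed.

(** An edge outside a spanning tree closes a cycle. *)
Lemma tree_parent_graph E r : is_tree E ->
  exists2 f, ptree finset.setT r f & E = parent_graph f.
Proof.
move=> [[Esym Eirr] Econ Eac].
have [f tf sE] := spanning_ptree r Esym Econ; exists f => //.
apply/eqP; rewrite finset.eqEsubset sE andbT; apply/fintype.subsetP => -[a b] abE.
apply/negPn/negP => abf.
have ab : a != b.
  by apply: contraTneq abE => ->; have := Eirr b; rewrite /adj => ->.
have /connectP[p0 pp0 lp0] := parent_graph_connected tf a b.
case/shortenP: pp0 lp0 => p pp up _ lp.
case: p pp up lp => [|x [|z s]] pp up lp.
- by rewrite /= in lp; rewrite lp eqxx in ab.
- by move: pp; rewrite /= andbT -[x]/(last a [:: x]) -lp /adj (negPf abf).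
apply: (Eac (a :: x :: z :: s)) => //.
rewrite /ucycle up andbT /cycle rcons_path -lp.
rewrite (sub_path _ pp) /=; last by move=> u v; apply: (fintype.subsetP sE).
by rewrite Esym.
Qed.

Lemma sum_rooted_trees (K : nmodType) (F : nat -> K) :
  (\sum_(T in rooted_trees n) F (nb_improper T) =
  \sum_(r : 'I_n) \sum_(f : {ffun 'I_n -> 'I_n} | ptree finset.setT r f)
     F (improper_count f))%R.
Proof.
rewrite pair_big_dep /=.
pose h (rf : 'I_n * {ffun 'I_n -> 'I_n}) : rooted_graph n :=
  (parent_graph rf.2, rf.1).
pose D := [set rf : 'I_n * {ffun 'I_n -> 'I_n} | ptree finset.setT rf.1 rf.2]%SET.
have -> : rooted_trees n = (h @: D)%SET.
  apply/finset.setP => -[E r]; rewrite inE; apply/asboolP/imsetP => /=.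
    move=> /(tree_parent_graph r)[f tf ->].
    by exists (r, f); rewrite ?inE.
  by move=> [[r' f]]; rewrite inE /= => tf [-> _]; exact: (parent_graph_tree tf).
rewrite big_imset /=; last first.
  move=> [r f] [r' f']; rewrite !inE /= => tf tf' [EE Er].
  rewrite -{}Er in tf' *; congr pair; apply/ffunP => v.
  have [->|vr] := eqVneq v r; first by rewrite (ptree_root tf) (ptree_root tf').
  have := parent_parent_graph tf (f v) v; rewrite EE (parent_parent_graph tf').
  by rewrite vr eqxx /= => /eqP.
apply: eq_big => [[r f]|[r f]]; rewrite inE //= => tf.
by rewrite (nb_improper_parent_graph tf).
Qed.

End TreeGraphs.

(** * A linear recurrence in the number of vertices *)

Section RamanujanPolynomials.

Variable K : comNzRingType.
Local Open Scope ring_scope.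
Implicit Types (a b e : nat -> {poly K}).

(** Defined by the linear recurrences [D A = 1] and [D B = B], with [D] as in
    [ramD] below.  The first sequence turns out to be the generating polynomials
    of the number of improper edges, the second those of the trees on [n + 1]
    vertices rooted at the smallest one. *)
Fixpoint tree_poly n : {poly K} :=
  if n is n'.+1 then
    (n' == 0%N)%:R + n'%:R * (1 + 'X) * tree_poly n' + 'X^2 * (tree_poly n')^`()
  else 0.

Fixpoint min_tree_poly n : {poly K} :=
  if n is n'.+1 then
    (n'%:R * (1 + 'X) + 1) * min_tree_poly n' + 'X^2 * (min_tree_poly n')^`()
  else 1.

Lemma tree_poly_rec n : tree_poly n.+1 =
  (n == 0%N)%:R + n%:R * (1 + 'X) * tree_poly n + 'X^2 * (tree_poly n)^`().
Proof. by []. Qed.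

Lemma min_tree_poly_rec n : min_tree_poly n.+1 =
  (n%:R * (1 + 'X) + 1) * min_tree_poly n + 'X^2 * (min_tree_poly n)^`().
Proof. by []. Qed.

Arguments tree_poly : simpl never.
Arguments min_tree_poly : simpl never.

(** Product of exponential generating functions. *)
Definition binconv a b n : {poly K} :=
  \sum_(i < n.+1) (a i * b (n - i)%N) *+ 'C(n, i).

(** The operator [(1 - (1 + y) x) d/dx - y^2 d/dy] on exponential generating
    functions in [x], with [y] the variable of the polynomials. *)
Definition ramD a n : {poly K} :=
  a n.+1 - n%:R * (1 + 'X) * a n - 'X^2 * (a n)^`().

Local Notation shift a := (fun n => a n.+1).

Lemma eq_binconv a a' b b' n : a =1 a' -> b =1 b' ->
  binconv a b n = binconv a' b' n.
Proof. by move=> ea eb; apply: eq_bigr => i _; rewrite ea eb. Qed.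

Lemma binconvZl c a b n : binconv (fun i => c * a i) b n = c * binconv a b n.
Proof. by rewrite mulr_sumr; apply: eq_bigr => i _; rewrite -mulrA mulrnAr. Qed.

Lemma binconv_delta a n : binconv a (fun i => (i == 0%N)%:R) n = a n.
Proof.
rewrite /binconv big_ord_recr /= subnn eqxx mulr1 binn mulr1n big1 ?add0r // => i _.
by rewrite subn_eq0 leqNgt ltn_ord mulr0 mul0rn.
Qed.

Lemma binconvS a b n :
  binconv a b n.+1 = binconv (shift a) b n + binconv a (shift b) n.
Proof.
rewrite {1}/binconv big_ord_recl /= subn0 bin0 mulr1n.
under eq_bigr => i _ do rewrite /bump /= add1n binS subSS mulrnDr.
rewrite big_split /= addrA addrC; congr (_ + _).
rewrite big_ord_recr /= bin_small // mulr0n addr0 [RHS]big_ord_recl /= bin0 subn0 mulr1n.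
congr (_ + _); apply: eq_bigr => i _; rewrite /bump /= add1n.
by rewrite subnS prednK // subn_gt0.
Qed.

(** [ramD] is a combination of the derivations [d/dx], [x d/dx] and [d/dy] of
    the ring of exponential generating functions, hence a derivation. *)
Lemma ramD_binconv a b n :
  ramD (binconv a b) n = binconv (ramD a) b n + binconv a (ramD b) n.
Proof.
rewrite /ramD binconvS.
have -> : n%:R * (1 + 'X) * binconv a b n =
    binconv (fun i => i%:R * (1 + 'X) * a i) b n +
    binconv a (fun i => i%:R * (1 + 'X) * b i) n.
  rewrite /binconv -big_split mulr_sumr; apply: eq_bigr => i _ /=.
  have -> : n%:R = i%:R + (n - i)%:R :> {poly K}.
    by rewrite -natrD subnKC // -ltnS.
  by rewrite -mulrnDl mulrnAr; congr (_ *+ _); ring.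
have -> : (binconv a b n)^`() =
    binconv (fun i => (a i)^`()) b n + binconv a (fun i => (b i)^`()) n.
  rewrite /binconv raddf_sum -big_split; apply: eq_bigr => i _ /=.
  by rewrite derivMn derivM mulrnDl.
rewrite /binconv mulrDr !mulr_sumr -!big_split /= -!sumrN -!big_split /=.
apply: eq_bigr => i _; rewrite !mulrBl !mulrBr !mulrnBl -!mulrnAr.
ring.
Qed.

(** The equation [D e = c e] is a recurrence that expresses [e (n + 1)] linearly
    in [e n] and its derivative. *)
Lemma ramD_eq0 c e : e 0%N = 0 -> (forall n, ramD e n = c * e n) ->
  forall n, e n = 0.
Proof.
move=> e0 De; elim=> [//|n IHn]; have := De n.
by rewrite /ramD IHn deriv0 !mulr0 !subr0.
Qed.

Lemma ramD_tree n : ramD tree_poly n = (n == 0%N)%:R.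
Proof. by rewrite /ramD tree_poly_rec; ring. Qed.

Lemma ramD_min_tree n : ramD min_tree_poly n = min_tree_poly n.
Proof. by rewrite /ramD min_tree_poly_rec; ring. Qed.

(** The commutation rule [D (d/dx) = (d/dx) D + (1 + y) (d/dx)]. *)
Lemma ramD_shift a n :
  ramD (shift a) n = ramD a n.+1 + (1 + 'X) * a n.+1.
Proof. by rewrite /ramD -natr1; ring. Qed.

(** The defect [e = A' - B - y A A'] satisfies [D e = e]: by the Leibniz and
    commutation rules, [D A' = (1 + y) A'], [D y = - y^2], [D A = 1] and
    [D B = B]. *)
Lemma tree_polyS n : tree_poly n.+1 =
  min_tree_poly n + 'X * binconv (shift tree_poly) tree_poly n.
Proof.
pose e (n : nat) : {poly K} := tree_poly n.+1 - min_tree_poly n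
            - 'X * binconv (shift tree_poly) tree_poly n.
suff : e n = 0 by rewrite /e -addrA -opprD => /subr0_eq.
move: n; apply: (@ramD_eq0 1) => [|n].
  rewrite /e /binconv big_ord_recl big_ord0 /= tree_poly_rec [tree_poly 0]/tree_poly deriv0.
  rewrite /min_tree_poly !(mul0r, mulr0, addr0, mul0rn) subr0; exact: subrr.
have -> : ramD e n = ramD (shift tree_poly) n - ramD min_tree_poly n
    - 'X * ramD (binconv (shift tree_poly) tree_poly) n
    + 'X^2 * binconv (shift tree_poly) tree_poly n.
  rewrite /ramD /e !derivB derivM derivX; ring.
rewrite ramD_binconv ramD_shift ramD_min_tree !ramD_tree /=.
rewrite (@eq_binconv (ramD (shift tree_poly))
  (fun i => (1 + 'X) * tree_poly i.+1) tree_poly tree_poly) //; last first.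
  by move=> i; rewrite ramD_shift ramD_tree add0r.
rewrite (@eq_binconv (shift tree_poly) (shift tree_poly) (ramD tree_poly)
  (fun i => (i == 0%N)%:R)) //; last exact: ramD_tree.
rewrite binconvZl (binconv_delta (shift tree_poly)) /e.
ring.
Qed.

(** Here the defect [e = B' - A' B] satisfies [D e = (2 + y) e]. *)
Lemma min_tree_polyS n :
  min_tree_poly n.+1 = binconv (shift tree_poly) min_tree_poly n.
Proof.
pose e (n : nat) : {poly K} := min_tree_poly n.+1 - binconv (shift tree_poly) min_tree_poly n.
suff : e n = 0 by rewrite /e => /subr0_eq.
move: n; apply: (@ramD_eq0 (2 + 'X)) => [|n].
  rewrite /e /binconv big_ord_recl big_ord0 /= min_tree_poly_rec tree_poly_rec.
  rewrite [tree_poly 0]/tree_poly [min_tree_poly 0]/min_tree_poly deriv0 poly.derivE.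
  rewrite bin0 !(mul0r, mulr0, mulr1, addr0, add0r, mulr1n); exact: subrr.
have -> : ramD e n = ramD (shift min_tree_poly) n
    - ramD (binconv (shift tree_poly) min_tree_poly) n.
  rewrite /ramD /e !derivB; ring.
rewrite ramD_binconv ramD_shift ramD_min_tree /=.
rewrite (@eq_binconv (ramD (shift tree_poly))
  (fun i => (1 + 'X) * tree_poly i.+1) min_tree_poly min_tree_poly) //; last first.
  by move=> i; rewrite ramD_shift ramD_tree add0r.
rewrite (@eq_binconv (shift tree_poly) (shift tree_poly) (ramD min_tree_poly)
  min_tree_poly) //; last exact: ramD_min_tree.
rewrite binconvZl /e; ring.
Qed.

Lemma sum_trees_polyE n :
  \sum_(T in rooted_trees n) 'X^(nb_improper T) = tree_poly n.
Proof.
rewrite (sum_rooted_trees _ (fun k => 'X^k)).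
rewrite -[n in RHS]card_ord -cardsT.
rewrite -(@total_weightE n _ 'X tree_poly min_tree_poly) //.
- by apply: eq_bigl => r; rewrite finset.in_setT.
- exact: tree_polyS.
- exact: min_tree_polyS.
Qed.

Definition tree_sum n (h : nat -> K) : K :=
  \sum_(T in rooted_trees n) h (nb_improper T).

Lemma nb_improper_le n (T : rooted_graph n) : (nb_improper T <= n * n)%N.
Proof. by rewrite (leq_trans (max_card _)) // card_prod card_ord. Qed.

(** The linear form sending [y^k] to [h k] for [k < N]. *)
Let pairing N (h : nat -> K) (p : {poly K}) : K := \sum_(k < N) p`_k * h k.

Let pairingXn N h m : (m < N)%N -> pairing N h 'X^m = h m.
Proof.
move=> mN; rewrite /pairing (bigD1 (Ordinal mN)) //= coefXn eqxx mul1r.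
by rewrite big1 ?addr0 // => i; rewrite -val_eqE coefXn => /negPf ->; rewrite mul0r.
Qed.

Let pairingD N h p q : pairing N h (p + q) = pairing N h p + pairing N h q.
Proof.
by rewrite /pairing -big_split; apply: eq_bigr => i _; rewrite coefD mulrDl.
Qed.

Let pairingMn N h p k : pairing N h (p *+ k) = pairing N h p *+ k.
Proof.
by rewrite /pairing -sumrMnl; apply: eq_bigr => i _; rewrite coefMn mulrnAl.
Qed.

Let pairing_sum N h (I : finType) (P : pred I) (F : I -> {poly K}) :
  pairing N h (\sum_(i | P i) F i) = \sum_(i | P i) pairing N h (F i).
Proof.
rewrite /pairing exchange_big; apply: eq_bigr => k _ /=.
by rewrite coef_sum mulr_suml.
Qed.

Lemma tree_sum1 h : tree_sum 1 h = h 0%N.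
Proof.
have := sum_trees_polyE 1.
rewrite tree_poly_rec [tree_poly 0]/tree_poly eqxx !mul0r deriv0 mulr0 addr0.
move=> /(congr1 (pairing 3 h)); rewrite pairing_sum.
have -> : pairing 3 h (true%:R + 0) = h 0%N.
  by rewrite addr0; exact: (@pairingXn 3 h 0).
move=> <-.
apply: eq_bigr => T _; rewrite pairingXn //.
by rewrite (leq_ltn_trans (nb_improper_le T)).
Qed.

(** The coefficients of the recurrence: a tree on [n] vertices with [k] improper
    edges accounts for [n] trees on [n + 1] vertices with [k] improper edges, and
    for [n + k] with [k + 1]. *)
Lemma tree_sumS n h : (0 < n)%N ->
  tree_sum n.+1 h =
  tree_sum n (fun k => n%:R * h k + (n + k)%:R * h k.+1).
Proof.
move=> n0; pose N := (n.+1 * n.+1).+2.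
have nbN m (T : rooted_graph m) : (m <= n.+1)%N -> ((nb_improper T).+1 < N)%N.
  move=> mn; rewrite !ltnS (leq_trans (nb_improper_le T)) // leq_mul //.
have := sum_trees_polyE n.+1.
rewrite tree_poly_rec -sum_trees_polyE (gtn_eqF n0) add0r raddf_sum !mulr_sumr -big_split /=.
move=> /(congr1 (pairing N h)); rewrite !pairing_sum => E.
rewrite (_ : tree_sum n.+1 h =
    \sum_(T in rooted_trees n.+1) pairing N h 'X^(nb_improper T)); last first.
  by apply: eq_bigr => T _; rewrite pairingXn // ltnW // nbN.
rewrite E; apply: eq_bigr => T _; set m := nb_improper T.
have -> : n%:R * (1 + 'X) * 'X^m + 'X^2 * ('X^m)^`() =
    'X^m *+ n + 'X^(m.+1) *+ (n + m) :> {poly K}.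
  rewrite derivXn; case: m => [|m] /=; last by rewrite !exprS; ring.
  by rewrite mulr0n; ring.
rewrite pairingD !pairingMn !pairingXn ?nbN //; last by rewrite ltnW // nbN.
by rewrite !mulr_natl.
Qed.

End RamanujanPolynomials.

(** * Cayley's formula *)

Section Cayley.

(** Weighted number of ways to make [m] growth steps from [n] vertices and [k] improper
    edges: [m! [x^m] e^(n w) (1 - w)^(- n - k)] where [w] is the tree function
    [w = x e^w], expanded by Lagrange's formula.  For [n + k = 1] the truncated
    subtraction gives the right binomials, [C(i - 1, i) = (i == 0)]. *)
Definition growth_count m n k : nat :=
  (\sum_(i < m.+1) m ^_ i * 'C(n + k + i - 2, i) * (n + m) ^ (m - i))%N.

Lemma growth_countS m n k : (0 < n)%N ->
  growth_count m.+1 n k =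
  (n * growth_count m n.+1 k + (n + k) * growth_count m n.+1 k.+1)%N.
Proof.
move=> n0; have [a nk] : exists a, (n + k = a.+1)%N.
  by exists (n + k).-1; rewrite prednK // addn_gt0 n0.
pose N := (n + m.+1)%N.
have E1 : growth_count m.+1 n k =
    (N ^ m.+1 + \sum_(j < m.+1) m.+1 * m ^_ j * 'C(a + j, j.+1) * N ^ (m - j))%N.
  rewrite /growth_count big_ord_recl /= ffactn0 bin0 !mul1n subn0; congr (_ + _)%N.
  apply: eq_bigr => j _; rewrite /bump /= add1n ffactSS subSS nk.
  by rewrite (_ : (a.+1 + j.+1 - 2 = a + j)%N) //; lia.
have E2 : growth_count m n.+1 k =
    (\sum_(j < m.+1) m ^_ j * 'C(a + j, j) * N ^ (m - j))%N.
  apply: eq_bigr => j _; rewrite addSn nk (addSnnS n m) -/N.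
  by rewrite (_ : (a.+2 + j - 2 = a + j)%N) //; lia.
have E3 : growth_count m n.+1 k.+1 =
    (\sum_(j < m.+1) m ^_ j * 'C(a.+1 + j, j) * N ^ (m - j))%N.
  apply: eq_bigr => j _; rewrite addSn addnS nk (addSnnS n m) -/N.
  by rewrite (_ : (a.+3 + j - 2 = a.+1 + j)%N) //; lia.
have E4 : (N * growth_count m n.+1 k =
    N ^ m.+1 + \sum_(j < m.+1) m ^_ j.+1 * 'C(a.+1 + j, j.+1) * N ^ (m - j))%N.
  rewrite E2 big_ord_recl /= ffactn0 bin0 !mul1n subn0 mulnDr -expnS.
  congr (_ + _)%N; rewrite [RHS]big_ord_recr /= ffact_small // !mul0n addn0.
  rewrite big_distrr; apply: eq_bigr => j _ /=.
  rewrite /bump /= add1n addnS addSn mulnCA -expnS; congr (_ * N ^ _)%N.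
  by rewrite subnSK.
(* adding this term turns the factor [n] into [N], which raises the power of [N] *)
apply: (@addIn (m.+1 * growth_count m n.+1 k)).
rewrite addnAC -mulnDl -/N E4 E1 E2 E3 !big_distrr /= -!addnA -!big_split /=.
congr (_ + _)%N; apply: eq_bigr => j _.
have jm : (j <= m)%N by rewrite -ltnS.
transitivity (m.+1 * m ^_ j * 'C(a.+1 + j, j.+1) * N ^ (m - j))%N.
  by rewrite addSn binS; ring.
have -> : ((n + k) * (m ^_ j * 'C(a.+1 + j, j) * N ^ (m - j)) =
    m ^_ j * (j.+1 * 'C(a.+1 + j, j.+1)) * N ^ (m - j))%N.
  by rewrite mul_bin_left addnK nk; ring.
rewrite ffactnSr -{1}(subnK jm); ring.
Qed.

Variable K : comNzRingType.

Lemma tree_sum_growth m n : (0 < n)%N ->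
  tree_sum (m + n) (fun=> 1 : K)%R =
  tree_sum n (fun k => (growth_count m n k)%:R)%R.
Proof.
elim: m n => [|m IHm] n n0.
  apply: eq_bigr => T _.
  by rewrite /growth_count big_ord_recl big_ord0 bin0.
rewrite addSnnS IHm // tree_sumS //; apply: eq_bigr => T _.
by rewrite growth_countS // -!natrM -natrD.
Qed.

(** For [n = 1] and [k = 0] only the first term of the growth count survives. *)
Theorem tree_sum_Cayley n : (0 < n)%N ->
  tree_sum n (fun=> 1 : K)%R = (n ^ n.-1)%:R%R.
Proof.
case: n => // n _; rewrite -addn1 tree_sum_growth // tree_sum1 /=.
congr (_%:R)%R; rewrite /growth_count big_ord_recl /= ffactn0 bin0 !mul1n subn0.
rewrite big1 ?addn0 ?addn1 ?add1n // => i _.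
by rewrite bin_small ?muln0 // /bump /=; lia.
Qed.

End Cayley.

(** * Taylor estimates *)

Section Taylor.

Variable R : realType.
Local Open Scope ring_scope.
Implicit Types (f df : R -> R) (x z t : R) (p : {poly R}).

(** The functions [M t^(K+1) / (K+1)! - s f t], for [s = 1] and [s = -1], vanish
    at 0 and have a nonnegative derivative. *)
Lemma integrate_bound f df (M : R) K :
    (forall t, 0 <= t -> is_derive t 1 f (df t)) -> f 0 = 0 ->
    (forall t, 0 <= t -> `|df t| <= M * (t ^+ K / K`!%:R)) ->
  forall z, 0 <= z -> `|f z| <= M * (z ^+ K.+1 / K.+1`!%:R).
Proof.
move=> fd f0 dfb z; rewrite le_eqVlt => /predU1P[<-|z0].
  by rewrite f0 normr0 expr0n /= mul0r mulr0.
have key (s : R) : `|s| = 1 -> s * f z <= M * (z ^+ K.+1 / K.+1`!%:R).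
  move=> s1; pose p : {poly R} := (M / K.+1`!%:R) *: 'X^(K.+1).
  have pE t : p.[t] = M * (t ^+ K.+1 / K.+1`!%:R).
    by rewrite hornerZ hornerXn mulrAC mulrA.
  pose g t : R := p.[t] - s * f t.
  have gd t : 0 <= t -> is_derive t 1 g (M * (t ^+ K / K`!%:R) - s * df t).
    move=> /fd fdt; apply: (is_derive_eq (is_deriveB (is_derive_poly p t) (is_deriveZ s fdt))).
    rewrite /p derivZ derivXn hornerZ hornerMn hornerXn /= factS natrM invfM.
    congr (_ - _); rewrite -mulr_natr.
    by field; rewrite pnatr_eq0 -lt0n fact_gt0 nat1r pnatr_eq0.
  have [t tz||c cz gE] := @MVT R g (fun t => M * (t ^+ K / K`!%:R) - s * df t) 0 z z0.
  - by apply: gd; move: tz; rewrite in_itv /= => /andP[/ltW].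
  - apply: derivable_within_continuous => t; rewrite in_itv /= => /andP[t0 _].
    by case: (gd t t0).
  have c0 : 0 <= c by move: cz; rewrite in_itv /= => /andP[/ltW].
  have : 0 <= g z - g 0.
    rewrite gE subr0; apply: mulr_ge0; last exact: ltW.
    rewrite subr_ge0 (le_trans _ (dfb c c0)) // (le_trans (ler_norm _)) //.
    by rewrite normrM s1 mul1r.
  rewrite /g f0 mulr0 !pE expr0n /= mul0r mulr0 !subr0 subr_ge0.
  by [].
rewrite ler_norml; apply/andP; split.
  by rewrite lerNl -mulN1r key // normrN normr1.
by rewrite -[f z]mul1r key // normr1.
Qed.

Definition expRN_poly K : {poly R} := \poly_(i < K) ((-1) ^+ i / i`!%:R).

Lemma expRN_taylor K z : 0 <= z ->
  `|expR (- z) - (expRN_poly K).[z]| <= z ^+ K / K`!%:R.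
Proof.
pose f k t : R := expR (- t) - (expRN_poly k).[t].
suff H k t : 0 <= t -> `|f k t| <= 1 * (t ^+ k / k`!%:R).
  by move=> z0; rewrite -[leRHS]mul1r; exact: H.
elim: k t => [|k IHk] t t0.
  rewrite /f horner_poly big_ord0 subr0 expr0 fact0 divr1 mulr1.
  by rewrite ger0_norm ?expR_ge0 // -expR0 ler_expR oppr_le0.
move: t t0; apply: (@integrate_bound (f k.+1) (fun t => - f k t)).
- move=> t _.
  have de : is_derive t 1 (fun t : R => expR (- t)) (expR (- t) * -1).
    exact: (@is_derive1_comp _ expR -%R t _ _ (is_derive_expR _) (is_deriveNid _ _)).
  apply: (is_derive_eq (is_deriveB de (is_derive_poly (expRN_poly k.+1) t))).
  have -> : (expRN_poly k.+1)^`() = - expRN_poly k.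
    apply/polyP => i; rewrite coef_deriv coefN !coef_poly ltnS; case: ifP => _.
      rewrite factS natrM invfM -mulr_natr exprS.
      by field; rewrite pnatr_eq0 -lt0n fact_gt0 nat1r pnatr_eq0.
    by rewrite mul0rn oppr0.
  by rewrite hornerN /f; ring.
- rewrite /f oppr0 expR0 horner_coef0 coef_poly /=.
  by rewrite expr0 fact0 divr1 subrr.
- by move=> t t0; rewrite normrN; exact: IHk.
Qed.

Definition ln1D_poly K : {poly R} :=
  \poly_(i < K.+1) (- (-1) ^+ i / i%:R).

Lemma ln1D_taylor K z : 0 <= z ->
  `|ln (1 + z) - (ln1D_poly K).[z]| <= z ^+ K.+1.
Proof.
move=> z0; pose f t : R := ln (1 + t) - (ln1D_poly K).[t].
have : `|f z| <= K`!%:R * (z ^+ K.+1 / K.+1`!%:R).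
  apply: (@integrate_bound f (fun t => (- t) ^+ K / (1 + t))) => //.
  - move=> t t0; have t1 : 0 < 1 + t by rewrite ltr_pwDl.
    have d1 : is_derive t 1 (fun t : R => 1 + t) 1.
      apply: (is_derive_eq (is_deriveD (is_derive_cst (1 : R) t 1) (is_derive_id t 1))).
      by rewrite add0r.
    have dln := is_derive1_comp (is_derive1_ln t1) d1.
    apply: (is_derive_eq (is_deriveB dln (is_derive_poly (ln1D_poly K) t))).
    have -> : (ln1D_poly K)^`() = \poly_(i < K) ((-1) ^+ i).
      apply/polyP => i; rewrite coef_deriv !coef_poly ltnS; case: ifP => _.
        by rewrite -mulr_natr exprS; field; rewrite nat1r pnatr_eq0.
      by rewrite mul0rn.
    rewrite horner_poly.
    have -> : \sum_(i < K) (-1) ^+ i * t ^+ i = (1 - (- t) ^+ K) / (1 + t).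
      have E := subrX1 (- t) K.
      rewrite (eq_bigr (fun i : 'I_K => (- t) ^+ i)); last first.
        by move=> i _; rewrite [RHS]exprNn.
      have -> : 1 - (- t) ^+ K = (1 + t) * \sum_(i < K) (- t) ^+ i.
        by rewrite -opprB E -mulNr opprB opprK.
      by rewrite mulrC mulKf // gt_eqF.
    by field; rewrite gt_eqF.
  - rewrite /f addr0 ln1 horner_coef0 coef_poly /=.
    by rewrite invr0 mulr0 subrr.
  - move=> t t0; rewrite mulrCA divff ?mulr1 ?pnatr_eq0 -?lt0n ?fact_gt0 //.
    rewrite normrM normrX normrN (ger0_norm t0) ler_piMr ?exprn_ge0 //.
    rewrite ger0_norm ?invr_ge0 ?addr_ge0 // invf_le1 ?lerDl //.
    by rewrite ltr_pwDl.
move=> /le_trans; apply; rewrite mulrCA ler_piMr ?exprn_ge0 //.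
rewrite ler_pdivrMr ?ltr0n ?fact_gt0 // mul1r ler_nat factS leq_pmull //.
Qed.

End Taylor.

(** * Asymptotic expansions in powers of 1/n *)

Section Expansions.

Variable R : realType.
Local Open Scope ring_scope.
Implicit Types (f g : nat -> R) (p q : {poly R}) (l : R).

Definition bigOinv K f :=
  exists C : R, forall n, (0 < n)%N -> `|f n| <= C / n%:R ^+ K.

Lemma bigOinv_ge0 K f : bigOinv K f ->
  exists2 C : R, 0 <= C & forall n, (0 < n)%N -> `|f n| <= C / n%:R ^+ K.
Proof.
move=> [C fC]; exists C => //; have := fC 1%N isT.
by rewrite expr1n divr1; apply: le_trans.
Qed.

Lemma eq_bigOinv K f g : (forall n, (0 < n)%N -> f n = g n) ->
  bigOinv K f -> bigOinv K g.
Proof. by move=> fg [C fC]; exists C => n n0; rewrite -fg // fC. Qed.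

Lemma bigOinv_bound K f g :
  (forall n, (0 < n)%N -> `|f n| <= `|g n|) -> bigOinv K g -> bigOinv K f.
Proof. by move=> fg [C gC]; exists C => n n0; rewrite (le_trans (fg n n0)) ?gC. Qed.

Lemma bigOinvD K f g : bigOinv K f -> bigOinv K g ->
  bigOinv K (fun n => f n + g n).
Proof.
move=> [C fC] [D gD]; exists (C + D) => n n0.
by rewrite mulrDl (le_trans (ler_normD _ _)) // lerD ?fC ?gD.
Qed.

Lemma bigOinvM K L f g : bigOinv K f -> bigOinv L g ->
  bigOinv (K + L) (fun n => f n * g n).
Proof.
move=> /bigOinv_ge0[C C0 fC] [D gD]; exists (C * D) => n n0.
by rewrite normrM exprD invfM mulrACA ler_pM // ?fC ?gD.
Qed.

Lemma bigOinv_cst l : bigOinv 0 (fun=> l).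
Proof. by exists `|l| => n _; rewrite expr0 divr1. Qed.

Lemma bigOinv_inv K : bigOinv K (fun n => n%:R^-1 ^+ K).
Proof.
by exists 1 => n n0; rewrite mul1r ger0_norm ?exprVn // invr_ge0 exprn_ge0.
Qed.

Lemma bigOinvZ K l f : bigOinv K f -> bigOinv K (fun n => l * f n).
Proof. by move=> Of; have := bigOinvM (bigOinv_cst l) Of. Qed.

Lemma bigOinv_le K L f : (K <= L)%N -> bigOinv L f -> bigOinv K f.
Proof.
move=> KL /bigOinv_ge0[C C0 fC]; exists C => n n0; rewrite (le_trans (fC n n0)) //.
rewrite ler_wpM2l // lef_pV2 ?posrE ?exprn_gt0 ?ltr0n //.
by rewrite ler_weXn2l // ler1n.
Qed.

Lemma bigOinvX K f : bigOinv 1 f -> bigOinv K (fun n => f n ^+ K).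
Proof.
move=> Of; elim: K => [|K IHK].
  by apply: eq_bigOinv (bigOinv_cst 1) => n _; rewrite expr0.
by apply: eq_bigOinv (bigOinvM Of IHK) => n _; rewrite exprS.
Qed.

Lemma bigOinvS K f : bigOinv K f -> bigOinv K (fun n => f n.+1).
Proof.
move=> /bigOinv_ge0[C C0 fC]; exists C => n n0; rewrite (le_trans (fC n.+1 _)) //.
rewrite ler_wpM2l // lef_pV2 ?posrE ?exprn_gt0 ?ltr0n //.
by rewrite lerXn2r ?nnegrE // ler_nat.
Qed.

Lemma bigOinv_mulN K f : bigOinv K.+1 f -> bigOinv K (fun n => n%:R * f n).
Proof.
move=> [C fC]; exists C => n n0; have nR : n%:R != 0 :> R by rewrite pnatr_eq0 -lt0n.
rewrite normrM ger0_norm // -ler_pdivlMl ?ltr0n // (le_trans (fC n n0)) //.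
by rewrite exprS invfM mulrCA.
Qed.

Lemma bigOinv1_cst l : bigOinv 1 (fun=> l) -> l = 0.
Proof.
move=> /bigOinv_ge0[C C0 lC]; apply/eqP/negPn/negP => l0.
have ln0 : 0 < `|l| by rewrite normr_gt0.
have [n nP] : exists n, C / `|l| < n%:R.
  by exists (Num.bound (C / `|l|)); apply: archi_boundP; rewrite divr_ge0.
have n0 : (0 < n)%N by rewrite -(ltr0n R) (le_lt_trans _ nP) ?divr_ge0.
have := lC n n0; rewrite expr1 ler_pdivlMr ?ltr0n //.
by rewrite leNgt mulrC -ltr_pdivrMr ?nP.
Qed.

Definition expandable f :=
  forall K, exists p, bigOinv K (fun n => f n - p.[n%:R^-1]).

(** An asymptotic expansion of [f] to all orders in [1/n], with constant term [l]. *)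
Definition expands_to f l := expandable f /\ bigOinv 1 (fun n => f n - l).

Lemma eq_expandable f g : (forall n, (0 < n)%N -> f n = g n) ->
  expandable f -> expandable g.
Proof.
move=> fg ef K; have [p fp] := ef K; exists p.
by apply: eq_bigOinv fp => n n0; rewrite fg.
Qed.

Lemma horner_bounded p : bigOinv 0 (fun n => p.[n%:R^-1]).
Proof.
exists (\sum_(i < size p) `|p`_i|) => n n0.
rewrite expr0 divr1 horner_coef (le_trans (ler_norm_sum _ _ _)) //.
apply: ler_sum => i _; rewrite normrM ler_piMr // normrX exprn_ile1 //.
by rewrite ger0_norm ?invr_ge0 // invf_le1 ?ltr0n // ler1n.
Qed.

Lemma expandable_bounded f : expandable f -> bigOinv 0 f.
Proof.
move=> /(_ 0%N)[p fp].
by apply: eq_bigOinv (bigOinvD fp (horner_bounded p)) => n _; rewrite subrK.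
Qed.

Lemma expandable_horner p : expandable (fun n => p.[n%:R^-1]).
Proof. by move=> K; exists p; exists 0 => n _; rewrite subrr normr0 mul0r. Qed.

(** To be expandable it is enough to be close to expandable sequences at every
    order, which need not be polynomials in [1/n]. *)
Lemma expandable_approx f :
  (forall K, exists2 g, expandable g & bigOinv K (fun n => f n - g n)) ->
  expandable f.
Proof.
move=> fg K; have [g eg fgK] := fg K; have [p gp] := eg K; exists p.
by apply: eq_bigOinv (bigOinvD fgK gp) => n _; rewrite subrKA.
Qed.

Lemma expandableD f g : expandable f -> expandable g ->
  expandable (fun n => f n + g n).
Proof.
move=> ef eg K; have [p fp] := ef K; have [q gq] := eg K; exists (p + q).
by apply: eq_bigOinv (bigOinvD fp gq) => n _; rewrite hornerD; ring.
Qed.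

Lemma expandableM f g : expandable f -> expandable g ->
  expandable (fun n => f n * g n).
Proof.
move=> ef eg K; have [p fp] := ef K; have [q gq] := eg K; exists (p * q).
have h1 := bigOinvM fp (expandable_bounded eg).
have h2 := bigOinvM (horner_bounded p) gq.
rewrite addn0 in h1.
by apply: eq_bigOinv (bigOinvD h1 h2) => n _; rewrite hornerM; ring.
Qed.

Lemma expandable_cst l : expandable (fun=> l).
Proof.
by apply: eq_expandable (expandable_horner l%:P) => n _; rewrite hornerC.
Qed.

Lemma expandable_inv : expandable (fun n => n%:R^-1).
Proof.
by apply: eq_expandable (expandable_horner 'X) => n _; rewrite hornerX.
Qed.

Lemma expandableX f k : expandable f -> expandable (fun n => f n ^+ k).
Proof.
move=> ef; elim: k => [|k IHk].
  by apply: eq_expandable (expandable_cst 1) => n _; rewrite expr0.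
by apply: eq_expandable (expandableM ef IHk) => n _; rewrite exprS.
Qed.

Lemma expandable_sum (I : Type) (s : seq I) (P : pred I) (F : I -> nat -> R) :
  (forall i, P i -> expandable (F i)) ->
  expandable (fun n => \sum_(i <- s | P i) F i n).
Proof.
move=> eF; elim: s => [|i s IHs].
  by apply: eq_expandable (expandable_cst 0) => n _; rewrite big_nil.
have [Pi|Pi] := boolP (P i).
  by apply: eq_expandable (expandableD (eF i Pi) IHs) => n _; rewrite big_cons Pi.
by apply: eq_expandable IHs => n _; rewrite big_cons (negPf Pi).
Qed.

Lemma expandable_poly p f : expandable f -> expandable (fun n => p.[f n]).
Proof.
move=> ef; apply: eq_expandable; first by move=> n _; rewrite horner_coef.
apply: expandable_sum => i _; apply: expandableM; last exact: expandableX.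
exact: expandable_cst.
Qed.

(** With [x = - 1/n] one has [1/(n + 1) = (1/n) / (1 - x)]: a geometric series. *)
Lemma expandable_invS : expandable (fun n => n.+1%:R^-1).
Proof.
apply: expandable_approx => K.
exists (fun n => (\sum_(i < K) (- 'X) ^+ i * 'X).[n%:R^-1]).
  exact: expandable_horner.
have h := bigOinvM (bigOinv_inv K) (bigOinvS (expandable_bounded expandable_inv)).
rewrite addn0 in h.
apply: eq_bigOinv (bigOinvZ ((-1) ^+ K) h) => n n0.
have nR : n%:R != 0 :> R by rewrite pnatr_eq0 -lt0n.
have nR1 : n.+1%:R != 0 :> R by rewrite pnatr_eq0.
rewrite -mulr_suml hornerM hornerX horner_sum.
rewrite (eq_bigr (fun i : 'I_K => (- n%:R^-1) ^+ i)); last first.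
  by move=> i _; rewrite horner_exp hornerN hornerX.
have -> : (n%:R^-1) ^+ K = (-1) ^+ K * (- n%:R^-1) ^+ K :> R.
  by rewrite -exprMn mulN1r opprK.
set x : R := - n%:R^-1.
have nx : n.+1%:R = n%:R * (1 - x) by rewrite /x mulrBr mulr1 mulrN divff // opprK -natr1.
have x1 : 1 - x != 0 by apply: contraNneq nR1 => x1; rewrite nx x1 mulr0.
rewrite mulrA mulrA -expr2 sqrr_sign mul1r.
have E : x ^+ K = 1 - (1 - x) * \sum_(i < K) x ^+ i.
  by rewrite -[1 - x]opprB mulNr -subrX1; ring.
rewrite E nx; field; rewrite nR x1 //.
Qed.

Lemma expandableS f : expandable f -> expandable (fun n => f n.+1).
Proof.
move=> ef; apply: expandable_approx => K; have [p fp] := ef K.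
exists (fun n => p.[n.+1%:R^-1]); last exact: (bigOinvS fp).
exact: expandable_poly expandable_invS.
Qed.

Lemma expandable_lim f : expandable f -> exists l, expands_to f l.
Proof.
move=> ef; have [p fp] := ef 1%N; exists p.[0]; split=> //.
have /factor_theorem[q qE] : root (p - p.[0]%:P) 0 by rewrite rootE !hornerE subrr.
have h := bigOinvM (horner_bounded q) (bigOinv_inv 1).
apply: eq_bigOinv (bigOinvD fp h) => n _.
have := congr1 (fun r : {poly R} => r.[n%:R^-1]) qE.
rewrite /= !hornerE subr0 expr1 => <-; ring.
Qed.

(** Every polynomial of the expansion beyond order 0 has constant term [l], so that
    [1/n] can be factored out of the difference. *)
Lemma expands_to_mulN f l : expands_to f l ->
  expandable (fun n => n%:R * (f n - l)).
Proof.
move=> [ef fl] K; have [p fp] := ef K.+1.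
have p0 : p.[0] = l.
  have /factor_theorem[q qE] : root (p - p.[0]%:P) 0 by rewrite rootE !hornerE subrr.
  have h := bigOinvM (horner_bounded q) (bigOinv_inv 1).
  have h2 := bigOinvZ (-1) (bigOinvD (bigOinv_le (isT : (1 <= K.+1)%N) fp) h).
  apply/eqP; rewrite -subr_eq0; apply/eqP/bigOinv1_cst.
  apply: eq_bigOinv (bigOinvD h2 fl) => n _.
  have := congr1 (fun r : {poly R} => r.[n%:R^-1]) qE.
  by rewrite /= hornerD hornerN hornerC hornerM hornerXsubC subr0 expr1; lra.
have /factor_theorem[q qE] : root (p - l%:P) 0 by rewrite rootE !hornerE p0 subrr.
exists q; apply: eq_bigOinv (bigOinv_mulN fp) => n n0.
have nR : n%:R != 0 :> R by rewrite pnatr_eq0 -lt0n.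
have := congr1 (fun r : {poly R} => r.[n%:R^-1]) qE.
rewrite /= !hornerE subr0 => /eqP; rewrite subr_eq => /eqP ->.
by field.
Qed.

Lemma eq_expands_to f g l : (forall n, (0 < n)%N -> f n = g n) ->
  expands_to f l -> expands_to g l.
Proof.
move=> fg [ef fl]; split; first exact: eq_expandable ef.
by apply: eq_bigOinv fl => n n0; rewrite fg.
Qed.

Lemma expands_to_cst l : expands_to (fun=> l) l.
Proof.
split; first exact: expandable_cst.
by exists 0 => n _; rewrite subrr normr0 mul0r.
Qed.

Lemma expands_toD f g l m : expands_to f l -> expands_to g m ->
  expands_to (fun n => f n + g n) (l + m).
Proof.
move=> [ef fl] [eg gm]; split; first exact: expandableD.
by apply: eq_bigOinv (bigOinvD fl gm) => n _; ring.
Qed.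

Lemma expands_toM f g l m : expands_to f l -> expands_to g m ->
  expands_to (fun n => f n * g n) (l * m).
Proof.
move=> [ef fl] [eg gm]; split; first exact: expandableM.
have h := bigOinvM fl (expandable_bounded eg); rewrite addn0 in h.
by apply: eq_bigOinv (bigOinvD h (bigOinvZ l gm)) => n _; ring.
Qed.

Lemma expands_toX f l k : expands_to f l -> expands_to (fun n => f n ^+ k) (l ^+ k).
Proof.
move=> fl; elim: k => [|k IHk].
  by apply: eq_expands_to (expands_to_cst 1) => n _; rewrite expr0.
by rewrite exprS; apply: eq_expands_to (expands_toM fl IHk) => n _; rewrite exprS.
Qed.

Lemma expands_toS f l : expands_to f l -> expands_to (fun n => f n.+1) l.
Proof. by move=> [ef fl]; split; [exact: expandableS|exact: bigOinvS fl]. Qed.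

Lemma expands_to_inv : expands_to (fun n => n%:R^-1) 0.
Proof.
split; first exact: expandable_inv.
by apply: eq_bigOinv (bigOinv_inv 1) => n _; rewrite subr0 expr1.
Qed.

Lemma expands_to_decay f k : (0 < k)%N -> expandable f ->
  expands_to (fun n => n%:R^-1 ^+ k * f n) 0.
Proof.
case: k => // k _ ef; have [l fl] := expandable_lim ef.
have := expands_toM (expands_toX k.+1 expands_to_inv) fl.
by rewrite exprS !mul0r.
Qed.

Lemma expands_to_sum0 (I : Type) (s : seq I) (P : pred I) (F : I -> nat -> R) :
  (forall i, P i -> expands_to (F i) 0) ->
  expands_to (fun n => \sum_(i <- s | P i) F i n) 0.
Proof.
move=> eF; elim: s => [|i s IHs].
  by apply: eq_expands_to (expands_to_cst 0) => n _; rewrite big_nil.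
have [Pi|Pi] := boolP (P i).
  have := expands_toD (eF i Pi) IHs; rewrite addr0.
  by apply: eq_expands_to => n _; rewrite big_cons Pi.
by apply: eq_expands_to IHs => n _; rewrite big_cons (negPf Pi).
Qed.

(** With [f n = l + v n / n], the increment of [f] is
    [(v (n + 1) - v n) / n - v (n + 1) / (n (n + 1))], of order [1/n^2]. *)
Lemma expands_to_diff f l : expands_to f l ->
  expands_to (fun n => n%:R * (f n.+1 - f n)) 0.
Proof.
move=> fl; have ev := expands_to_mulN fl; have [m vm] := expandable_lim ev.
have h1 := expands_toD (expands_toS vm) (expands_toM (expands_to_cst (-1)) vm).
have h2 := expands_toM (expands_to_decay (isT : (0 < 1)%N) ev) (expands_to_cst (-1)).
have h3 := expands_toM (expands_toS expands_to_inv) (expands_toS vm).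
have := expands_toD h1 (expands_toM (expands_to_cst (-1)) h3).
rewrite mul0r mulr0 addr0 mulN1r subrr; apply: eq_expands_to => n n0.
have nR : n%:R != 0 :> R by rewrite pnatr_eq0 -lt0n.
have nR1 : n%:R + 1 != 0 :> R by rewrite natr1 pnatr_eq0.
by rewrite -!natr1; field.
Qed.

End Expansions.

(** * The sequence (1 + 1/n)^n *)

Section EulerSequence.

Variable R : realType.
Local Open Scope ring_scope.

Definition euler_seq (n : nat) : R := (1 + n%:R^-1) ^+ n.

(** Then [(1 + 1/n)^n = e exp(- z n)], where [z n = 1/(2 n) + O(1/n^2)] is
    nonnegative. *)
Let z (n : nat) : R := 1 - n%:R * ln (1 + n%:R^-1).

Let z_ge0 n : (0 < n)%N -> 0 <= z n.
Proof.
move=> n0; rewrite subr_ge0 -ler_pdivlMl ?ltr0n // mulr1 le_ln1Dx //.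
by rewrite (@lt_le_trans _ _ 0) ?ltrN10 // invr_ge0.
Qed.

Let z_taylor K :
  bigOinv K (fun n => z n - (1 - (\poly_(i < K) ((-1) ^+ i / i.+1%:R)).[n%:R^-1])).
Proof.
have h : bigOinv K.+1 (fun n => ln (1 + n%:R^-1) - (ln1D_poly R K).[n%:R^-1]).
  apply: bigOinv_bound (bigOinv_inv R K.+1) => n n0.
  rewrite [leRHS]ger0_norm ?exprn_ge0 ?invr_ge0 //.
  by apply: ln1D_taylor; rewrite invr_ge0.
apply: eq_bigOinv (bigOinvZ (-1) (bigOinv_mulN h)) => n n0.
have nR : n%:R != 0 :> R by rewrite pnatr_eq0 -lt0n.
rewrite /z /ln1D_poly !horner_poly big_ord_recl /= invr0 mulr0 mul0r add0r.
have -> : n%:R * (ln (1 + n%:R^-1) -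
      \sum_(i < K) - (-1) ^+ bump 0 i / (bump 0 i)%:R * n%:R^-1 ^+ bump 0 i) =
    n%:R * ln (1 + n%:R^-1) - \sum_(i < K) (-1) ^+ i / i.+1%:R * n%:R^-1 ^+ i :> R.
  rewrite mulrBr mulr_sumr; congr (_ - _); apply: eq_bigr => i _.
  rewrite /bump /= add1n !exprS; field.
  by rewrite nR nat1r pnatr_eq0.
ring.
Qed.

Let z_expandable : expandable z.
Proof.
move=> K; exists (1 - \poly_(i < K) ((-1) ^+ i / i.+1%:R)).
by apply: eq_bigOinv (z_taylor K) => n _; rewrite hornerD hornerN hornerC.
Qed.

Let z_first_order : bigOinv 2 (fun n => z n - n%:R^-1 / 2).
Proof.
apply: eq_bigOinv (z_taylor 2) => n _; rewrite horner_poly !big_ord_recl big_ord0 /=.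
by rewrite (_ : bump 0 0 = 1%N) // !expr0 !expr1; lra.
Qed.

Let z_O1 : bigOinv 1 z.
Proof.
have h := bigOinvZ (2^-1) (bigOinv_inv R 1).
apply: eq_bigOinv (bigOinvD (bigOinv_le (isT : (1 <= 2)%N) z_first_order) h) => n _.
by rewrite expr1; ring.
Qed.

Let expz_taylor K : bigOinv K (fun n => expR (- z n) - (expRN_poly R K).[z n]).
Proof.
apply: bigOinv_bound (bigOinvX K z_O1) => n n0.
rewrite (le_trans (expRN_taylor _ (z_ge0 n0))) //.
rewrite ger0_norm ?exprn_ge0 ?z_ge0 // ler_piMr ?exprn_ge0 ?z_ge0 //.
by rewrite invf_le1 ?ltr0n ?fact_gt0 // ler1n fact_gt0.
Qed.

Lemma euler_seqE n : (0 < n)%N -> euler_seq n = expR 1 * expR (- z n).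
Proof.
move=> n0; rewrite -expRD /z opprB addrC subrK.
have n1 : 0 < 1 + n%:R^-1 :> R by rewrite ltr_pwDl // invr_ge0.
by rewrite mulr_natl -lnXn // lnK // posrE exprn_gt0.
Qed.

Lemma euler_seq_lim : expands_to euler_seq (expR 1).
Proof.
split.
  apply: (@eq_expandable _ (fun n => expR 1 * expR (- z n))).
    by move=> n n0; rewrite euler_seqE.
  apply: expandableM; first exact: expandable_cst.
  apply: expandable_approx => K; exists (fun n => (expRN_poly R K).[z n]).
    exact: expandable_poly.
  exact: expz_taylor.
apply: eq_bigOinv (bigOinvZ (expR 1) (expz_taylor 1)) => n n0.
rewrite horner_poly big_ord_recl big_ord0 /= expr0 fact0 euler_seqE //.
by rewrite expr0; field.
Qed.

Lemma euler_seq_correction :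
  expands_to (fun n => n%:R * (euler_seq n - expR 1)) (- expR 1 / 2).
Proof.
split; first exact: expands_to_mulN euler_seq_lim.
have h1 := bigOinvZ (expR 1) (bigOinv_mulN (expz_taylor 2)).
have h2 := bigOinvZ (- expR 1) (bigOinv_mulN z_first_order).
apply: eq_bigOinv (bigOinvD h1 h2) => n n0.
have nR : n%:R != 0 :> R by rewrite pnatr_eq0 -lt0n.
rewrite horner_poly !big_ord_recl big_ord0 /= euler_seqE //.
by rewrite (_ : bump 0 0 = 1%N) // !expr0 !expr1 fact0 (_ : 1`! = 1%N) //; field.
Qed.

End EulerSequence.

(** * Centred moments of the number of improper edges *)

Section TreeExpectation.

Variable R : realType.
Local Open Scope ring_scope.
Implicit Types (h : nat -> R) (n k p : nat).

Definition tree_expect n h : R := tree_sum n h / (n ^ n.-1)%:R.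

Lemma eq_tree_expect n h h' : h =1 h' -> tree_expect n h = tree_expect n h'.
Proof. by move=> hh; congr (_ / _); apply: eq_bigr => T _. Qed.

Lemma tree_expectD n h h' :
  tree_expect n (fun k => h k + h' k) = tree_expect n h + tree_expect n h'.
Proof. by rewrite /tree_expect /tree_sum big_split mulrDl. Qed.

Lemma tree_expectZ n c h : tree_expect n (fun k => c * h k) = c * tree_expect n h.
Proof. by rewrite /tree_expect /tree_sum -mulr_sumr mulrA. Qed.

Lemma tree_expect_sum n (I : Type) (s : seq I) (P : pred I) (F : I -> nat -> R) :
  tree_expect n (fun k => \sum_(i <- s | P i) F i k) =
  \sum_(i <- s | P i) tree_expect n (F i).
Proof. by rewrite /tree_expect /tree_sum exchange_big /= mulr_suml. Qed.

Lemma tree_expect1 n : (0 < n)%N -> tree_expect n (fun=> 1) = 1.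
Proof.
move=> n0; rewrite /tree_expect tree_sum_Cayley // divff // pnatr_eq0.
by rewrite -lt0n expn_gt0 n0.
Qed.

(** The number of trees grows from [n^(n-1)] to [(n+1)^n = n^(n-1) n (1 + 1/n)^n]. *)
Lemma tree_expectS n h : (0 < n)%N ->
  n%:R * euler_seq R n * tree_expect n.+1 h =
  tree_expect n (fun k => n%:R * h k + (n%:R + k%:R) * h k.+1).
Proof.
move=> n0; rewrite /tree_expect tree_sumS //=.
have nR : n%:R != 0 :> R by rewrite pnatr_eq0 -lt0n.
have nR1 : n.+1%:R != 0 :> R by rewrite pnatr_eq0.
have -> : (n.+1 ^ n)%:R = (n ^ n.-1)%:R * n%:R * euler_seq R n :> R.
  rewrite -natrM -expnSr prednK // !natrX /euler_seq -exprMn; congr (_ ^+ _).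
  by rewrite mulrDr divff // mulr1 natr1.
have en0 : euler_seq R n != 0 by rewrite gt_eqF // exprn_gt0 // ltr_pwDl // invr_ge0.
have nn0 : (n ^ n.-1)%:R != 0 :> R by rewrite pnatr_eq0 -lt0n expn_gt0 n0.
have -> : tree_sum n (fun k => n%:R * h k + (n + k)%:R * h k.+1) =
  tree_sum n (fun k => n%:R * h k + (n%:R + k%:R) * h k.+1).
  by apply: eq_bigr => T _; rewrite natrD.
by field; rewrite nR en0 nn0.
Qed.

Local Notation e := (expR 1 : R).
Local Notation mu := (e - 2).
Local Notation sigma2 := (e ^+ 2 - 3 * e + 1).

Definition cmoment p n : R := tree_expect n (fun k => (k%:R - mu * n%:R) ^+ p).

(** What matters is [beta 0 = e] and [beta 1 = - sigma2]. *)
Let beta j : R := (- mu) ^+ j + (1 + mu) * (1 - mu) ^+ j.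

(** This is [tree_expectS] for [h k = (k - mu (n + 1))^p], expanded in powers of
    [k - mu n]; note that [n + k = (k - mu n) + (1 + mu) n]. *)
Lemma cmoment_rec p n : (0 < n)%N ->
  n%:R * euler_seq R n * cmoment p n.+1 =
  \sum_(j < p.+1) 'C(p, j)%:R *
    (n%:R * beta j * cmoment (p - j) n + (1 - mu) ^+ j * cmoment (p - j).+1 n).
Proof.
move=> n0; rewrite /cmoment tree_expectS //.
rewrite (@eq_tree_expect _ _ (fun k => \sum_(j < p.+1) 'C(p, j)%:R *
    (n%:R * beta j * (k%:R - mu * n%:R) ^+ (p - j) +
     (1 - mu) ^+ j * (k%:R - mu * n%:R) ^+ (p - j).+1))).
  rewrite tree_expect_sum; apply: eq_bigr => j _.
  by rewrite tree_expectZ tree_expectD !tree_expectZ.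
move=> k; set W : R := k%:R - mu * n%:R.
have -> : k%:R - mu * n.+1%:R = W + - mu by rewrite /W -natr1; ring.
have -> : k.+1%:R - mu * n.+1%:R = W + (1 - mu) by rewrite /W -!natr1; ring.
have -> : n%:R + k%:R = W + (1 + mu) * n%:R by rewrite /W; ring.
have exprDE (x y : R) : (x + y) ^+ p =
    \sum_(j < p.+1) 'C(p, j)%:R * (x ^+ (p - j) * y ^+ j).
  by rewrite exprDn; apply: eq_bigr => j _; rewrite mulr_natl.
rewrite !exprDE !mulr_sumr -big_split; apply: eq_bigr => j _ /=.
by rewrite /beta exprS; ring.
Qed.

Lemma cmomentS p n : (0 < n)%N ->
  cmoment p.+1 n = n%:R * (euler_seq R n * cmoment p n.+1 - e * cmoment p n)
   - \sum_(j < p) 'C(p, j.+1)%:R *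
       (n%:R * beta j.+1 * cmoment (p - j.+1) n
        + (1 - mu) ^+ j.+1 * cmoment (p - j) n).
Proof.
move=> n0; rewrite mulrBr mulrA cmoment_rec // big_ord_recl /= bin0 subn0 /beta.
rewrite !expr0; under eq_bigr => j _ do rewrite /bump /= add1n subnSK //.
ring.
Qed.

(** The moment of order [2 q] of the normal law with variance [sigma2]. *)
Fixpoint gauss_moment q : R :=
  if q is q'.+1 then (q'.*2.+1)%:R * sigma2 * gauss_moment q' else 1.

Let scaled s p n : R := n%:R^-1 ^+ s * cmoment p n.

Let scaled_expandable s p : (p./2 <= s)%N ->
  expandable (scaled p./2 p) -> expandable (scaled s p).
Proof.
move=> ps ep; have := expandableM (expandableX (s - p./2) (expandable_inv R)) ep.
by apply: eq_expandable => n _; rewrite /scaled mulrA -exprD subnK.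
Qed.

Let scaled_decay s p : (p./2 < s)%N ->
  expandable (scaled p./2 p) -> expands_to (scaled s p) 0.
Proof.
move=> ps ep.
have sp : (0 < s - p./2)%N by rewrite subn_gt0.
have := expands_to_decay sp ep.
by apply: eq_expands_to => n _; rewrite /scaled mulrA -exprD subnK // ltnW.
Qed.

(** Here [e_n] tends to [e], and passing from [n] to [n + 1] does not change the
    leading coefficient. *)
Let scaled_shift q p l : expands_to (scaled q p) l ->
  expands_to (fun n => euler_seq R n * (n%:R^-1 ^+ q * cmoment p n.+1)
                       - e * scaled q p n) 0.
Proof.
move=> epl.
have e1 : expands_to (fun n => (1 + n%:R^-1) ^+ q : R) 1.
  have := expands_toX q (expands_toD (expands_to_cst 1) (expands_to_inv R)).
  by rewrite addr0 expr1n.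
have h1 := expands_toM (euler_seq_lim R) (expands_toM e1 (expands_toS epl)).
have h2 := expands_toM (expands_to_cst (- e)) epl.
have := expands_toD h1 h2; rewrite mul1r mulNr subrr.
apply: eq_expands_to => n n0; rewrite mulNr /scaled; congr (_ * _ - _).
rewrite mulrA -exprMn; congr (_ ^+ _ * _).
have nR : n%:R != 0 :> R by rewrite pnatr_eq0 -lt0n.
by rewrite -natr1; field; rewrite nR natr1 pnatr_eq0.
Qed.

(** By induction on [p], through [cmomentS].  In the step to an odd order, the
    factor [n] of the leading difference is compensated by [scaled_shift].  In the
    step from [p = 2 q + 1] to [2 q + 2], the leading difference and the terms
    beyond the first one of the sum are negligible; the first one contributes
    [- p beta 1 n] times the moment of order [2 q], hence the factor
    [(2 q + 1) sigma2]. *)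
Theorem cmoment_expands p :
  expandable (fun n => n%:R^-1 ^+ p./2 * cmoment p n) /\
  forall q, p = q.*2 ->
    expands_to (fun n => n%:R^-1 ^+ p./2 * cmoment p n) (gauss_moment q).
Proof.
have [k] := ubnP p; elim: k p => // k IHk [|p].
  have c0 : expands_to (fun n => n%:R^-1 ^+ 0 * cmoment 0 n) 1.
    apply: eq_expands_to (expands_to_cst 1) => n n0.
    rewrite expr0 mul1r /cmoment (@eq_tree_expect _ _ (fun=> 1)) ?tree_expect1 //.
  by move=> _; split=> [|[]//]; case: c0.
rewrite ltnS => pk.
have IHe i : (i <= p)%N -> expandable (scaled i./2 i).
  by move=> ip; apply: (IHk _ _).1; apply: leq_ltn_trans ip pk.
have [|m mq] := expandable_lim (IHe p _); first by [].
have [q [pq|pq]] : exists q, p = q.*2 \/ p = q.*2.+1.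
  exists p./2; rewrite -{1 3}(odd_double_half p).
  by case: (odd p); [right|left].
(* from an even to an odd order *)
- split; last by move=> q' E; move: (congr1 odd E); rewrite pq /= !odd_double.
  have pE : p.+1./2 = q by rewrite pq /= uphalf_double.
  rewrite pE; rewrite pq doubleK in mq; rewrite -pq in mq.
  have eA := expands_to_mulN (scaled_shift mq).
  have eB : expandable (fun n => \sum_(j < p) 'C(p, j.+1)%:R *
       (beta j.+1 * scaled q.-1 (p - j.+1) n
        + (1 - mu) ^+ j.+1 * scaled q (p - j) n)).
    apply: expandable_sum => j _; apply: expandableM; first exact: expandable_cst.
    apply: expandableD; (apply: expandableM; first exact: expandable_cst);
      apply: scaled_expandable; try (apply: IHe; lia); have := ltn_ord j; lia.
  apply: eq_expandable (expandableD eA (expandableM (expandable_cst (-1)) eB)).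
  move=> n n0; have nR : n%:R != 0 :> R by rewrite pnatr_eq0 -lt0n.
  rewrite cmomentS // subr0 mulN1r [RHS]mulrBr; congr (_ - _).
    by rewrite /scaled; ring.
  rewrite mulr_sumr; apply: eq_bigr => j _.
  have q0 : (0 < q)%N by have := ltn_ord j; lia.
  have -> : scaled q.-1 (p - j.+1) n = n%:R * scaled q (p - j.+1) n.
    by rewrite /scaled -{2}(prednK q0) exprS; field.
  by rewrite /scaled; ring.
(* from an odd to an even order *)
- suff H : expands_to (scaled p.+1./2 p.+1) (gauss_moment q.+1).
    split=> [|q' E]; first by case: H.
    suff -> : q' = q.+1 by [].
    by apply: double_inj; rewrite -E pq doubleS.
  have pE : p.+1./2 = q.+1 by rewrite pq /= doubleK.
  rewrite pE; have p2 : p./2 = q by rewrite pq /= uphalf_double.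
  rewrite p2 in mq.
  have eA := scaled_shift mq.
  have eT j : (j < p)%N -> (0 < j)%N -> expands_to (fun n => 'C(p, j.+1)%:R *
       (beta j.+1 * scaled q (p - j.+1) n
        + (1 - mu) ^+ j.+1 * scaled q.+1 (p - j) n)) 0.
    move=> jp j0.
    have h1 : expands_to (scaled q (p - j.+1)) 0.
      by apply: scaled_decay; [lia|apply: IHe; lia].
    have h2 : expands_to (scaled q.+1 (p - j)) 0.
      by apply: scaled_decay; [lia|apply: IHe; lia].
    have := expands_toM (expands_to_cst ('C(p, j.+1)%:R : R)) (expands_toD
      (expands_toM (expands_to_cst (beta j.+1)) h1)
      (expands_toM (expands_to_cst ((1 - mu) ^+ j.+1)) h2)).
    by rewrite !mulr0 addr0 mulr0.
  have e0 : expands_to (fun n => 'C(p, 1)%:R *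
       (beta 1 * scaled q (p - 1) n + (1 - mu) ^+ 1 * scaled q.+1 p n))
       (p%:R * beta 1 * gauss_moment q).
    have h1 : expands_to (scaled q (p - 1)) (gauss_moment q).
      have p1E : (p - 1 = q.*2)%N by lia.
      have p1k : (p - 1 < k)%N by lia.
      have := (IHk (p - 1)%N p1k).2 q p1E.
      by rewrite {1}p1E doubleK.
    have h2 : expands_to (scaled q.+1 p) 0.
      by apply: scaled_decay; [lia|apply: IHe].
    have := expands_toM (expands_to_cst ('C(p, 1)%:R : R)) (expands_toD
      (expands_toM (expands_to_cst (beta 1)) h1)
      (expands_toM (expands_to_cst ((1 - mu) ^+ 1)) h2)).
    by rewrite mulr0 addr0 bin1 mulrA.
  have eB : expands_to (fun n => \sum_(j < p) 'C(p, j.+1)%:R *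
       (beta j.+1 * scaled q (p - j.+1) n
        + (1 - mu) ^+ j.+1 * scaled q.+1 (p - j) n))
       (p%:R * beta 1 * gauss_moment q).
    rewrite pq; rewrite pq in e0 eT.
    have eS : expands_to (fun n => \sum_(j < q.*2) 'C(q.*2.+1, j.+2)%:R *
       (beta j.+2 * scaled q (q.*2.+1 - j.+2) n
        + (1 - mu) ^+ j.+2 * scaled q.+1 (q.*2.+1 - j.+1) n)) 0.
      by apply: expands_to_sum0 => j _; apply: eT; rewrite ?ltnS.
    have := expands_toD e0 eS; rewrite addr0.
    by apply: eq_expands_to => n _; rewrite [RHS]big_ord_recl.
  have := expands_toD eA (expands_toM (expands_to_cst (-1)) eB).
  have -> : 0 + -1 * (p%:R * beta 1 * gauss_moment q) = gauss_moment q.+1.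
    by rewrite /= -pq /beta; ring.
  apply: eq_expands_to => n n0.
  have nR : n%:R != 0 :> R by rewrite pnatr_eq0 -lt0n.
  rewrite /scaled cmomentS // mulN1r [RHS]mulrBr; congr (_ - _).
    by rewrite exprS; field.
  rewrite mulr_sumr; apply: eq_bigr => j _.
  by rewrite [n%:R^-1 ^+ q.+1]exprS; field.
Qed.

(** The recurrence for [h = 1], where [n h k + (n + k) h (k + 1) = 2 n + k]. *)
Lemma tree_expect_mean n : (0 < n)%N ->
  tree_expect n (fun k => k%:R) = n%:R * euler_seq R n - 2 * n%:R.
Proof.
move=> n0; have := tree_expectS (fun=> 1) n0; rewrite tree_expect1 // mulr1 => ->.
rewrite (@eq_tree_expect n (fun k => n%:R * 1 + (n%:R + k%:R) * 1)
  (fun k => 2 * n%:R * 1 + k%:R)); last by move=> k; ring.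
by rewrite tree_expectD tree_expectZ tree_expect1 //; ring.
Qed.

(** The recurrence for [h k = k]. *)
Lemma tree_expect_sqr n : (0 < n)%N ->
  tree_expect n (fun k => k%:R ^+ 2) =
  n%:R * euler_seq R n * (n.+1%:R * euler_seq R n.+1 - 2 * n.+1%:R)
  - (2 * n%:R + 1) * (n%:R * euler_seq R n - 2 * n%:R) - n%:R.
Proof.
move=> n0; rewrite -(tree_expect_mean n0) -(tree_expect_mean (ltn0Sn n)).
rewrite tree_expectS //.
rewrite (@eq_tree_expect n (fun k => n%:R * k%:R + (n%:R + k%:R) * k.+1%:R)
  (fun k => (2 * n%:R + 1) * k%:R + (n%:R * 1 + k%:R ^+ 2))).
  by rewrite tree_expectD tree_expectZ tree_expectD tree_expectZ tree_expect1 //; ring.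
by move=> k; rewrite -natr1; ring.
Qed.

Lemma mean_expands :
  bigOinv 1 (fun n => tree_expect n (fun k => k%:R) - (mu * n%:R - e / 2)).
Proof.
apply: eq_bigOinv (euler_seq_correction R).2 => n n0.
by rewrite tree_expect_mean //; ring.
Qed.

(** With [e_n = (1 + 1/n)^n] the variance is
    [n^2 e_n (e_(n+1) - e_n) + n e_n e_(n+1) - 3 n e_n + n]; it is expanded by
    means of [u n = n (e_n - e)], which tends to [- e/2]. *)
Lemma variance_expands :
  bigOinv 1 (fun n => tree_expect n (fun k => k%:R ^+ 2)
     - tree_expect n (fun k => k%:R) ^+ 2 - (sigma2 * n%:R + e * (3 - e) / 2)).
Proof.
pose u n : R := n%:R * (euler_seq R n - e).
have hu : expands_to u (- e / 2) := euler_seq_correction R.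
have hd := expands_to_diff hu.
have hi : expands_to (fun n => n.+1%:R^-1 : R) 0 := expands_toS (expands_to_inv R).
have hj : expands_to (fun n => n%:R / n.+1%:R : R) 1.
  have := expands_toD (expands_to_cst 1) (expands_toM (expands_to_cst (-1)) hi).
  rewrite mulr0 addr0; apply: eq_expands_to => n n0.
  by rewrite -natr1; field; rewrite natr1 pnatr_eq0.
have he := euler_seq_lim R; have heS := expands_toS he; have huS := expands_toS hu.
have h1 := expands_toM he (expands_toM hj
   (expands_toD hd (expands_toM (expands_to_cst (-1)) hu))).
have h2 := expands_toD (expands_toM hu heS)
  (expands_toM (expands_to_cst e) (expands_toM hj huS)).
have h3 := expands_toM (expands_to_cst (-3)) hu.
have := (expands_toD h1 (expands_toD h2 h3)).2.
apply: eq_bigOinv => n n0.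
have nR : n%:R != 0 :> R by rewrite pnatr_eq0 -lt0n.
have nR1 : n%:R + 1 != 0 :> R by rewrite natr1 pnatr_eq0.
rewrite tree_expect_sqr // tree_expect_mean // /u -!natr1.
by field.
Qed.

End TreeExpectation.

(** * Moments of the normal law *)

Section NormalLaw.

Variable R : realType.
Local Open Scope ring_scope.
Local Notation lambda := (@lebesgue_measure R).
Local Notation phi := (@normal_pdf R 0 1).
Implicit Types (f g F : R -> R) (x t c : R).

(** The fundamental theorem on [-n, n], then dominated convergence. *)
Lemma Rintegral_derivative_eq0 F f :
  (forall x, is_derive x 1 F (f x)) -> continuous f ->
  lambda.-integrable setT (EFin \o f) ->
  (F n%:R @[n --> \oo] --> 0)%classic -> (F (- n%:R) @[n --> \oo] --> 0)%classic ->
  (\int[lambda]_x f x)%R = 0.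
Proof.
move=> dF cf intf Fp Fm.
have Fcont : continuous F.
  by move=> x; apply/differentiable_continuous/derivable1_diffP; case: (dF x).
pose D (n : nat) : set R := [set` `[- n%:R, n%:R]%R]%classic.
pose fn (n : nat) : R -> \bar R := (fun x => ((f \_ (D n)) x)%:E).
have mf : measurable_fun setT f by exact: continuous_measurable_fun.
have fnE n : (\int[lambda]_x fn n.+1 x = (F n.+1%:R - F (- n.+1%:R))%:E)%E.
  have -> : (\int[lambda]_x fn n.+1 x =
             \int[lambda]_(x in D n.+1) (f x)%:E)%E.
    rewrite [RHS]integral_mkcond; apply: eq_integral => x _.
    by rewrite /fn restrict_EFin.
  rewrite /D.
  rewrite (@continuous_FTC2 _ f F) ?EFinB //.
  - by rewrite (@lt_trans _ _ 0) // ?oppr_lt0 ltr0n.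
  - exact: continuous_subspaceT.
  - split=> [x _||]; first by case: (dF x).
      by apply: cvg_at_right_filter; exact: Fcont.
    by apply: cvg_at_left_filter; exact: Fcont.
  - by move=> x _; rewrite derive1E; apply: derive_val.
have cvg1 : ((fun n => \int[lambda]_x fn n.+1 x)%E @ \oo --> (0 : \bar R))%classic.
  under eq_fun do rewrite fnE.
  apply: cvg_EFin; first exact: nearW.
  rewrite -(subr0 0); apply: cvgB.
    by move: Fp; rewrite -(cvg_shiftS (fun n => F n%:R)).
  by move: Fm; rewrite -(cvg_shiftS (fun n => F (- n%:R))).
have fn_n : (forall n, measurable_fun setT (fn n)).
  move=> n; apply/measurable_EFinP; apply/measurable_restrict => //.
    exact: measurable_itv.
  exact: measurable_funS mf.
have fn_f : {ae lambda, forall x, setT x -> (fn ^~ x @ \oo --> (EFin \o f) x)%classic}.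
  apply: aeW => x _; apply: cvg_EFin; first exact: nearW.
  apply: cvg_near_cst.
  exists (Num.bound `|x|) => // n /= nx.
  rewrite /fn /= patchE mem_set //= /D /= in_itv /= -ler_norml.
  have /ltW/le_trans := archi_boundP (normr_ge0 x); apply.
  by rewrite ler_nat.
have fn_le : {ae lambda, forall x n, setT x -> (`|fn n x| <= (`|f x|)%:E)%E}.
  apply: aeW => x n _; rewrite /fn lee_fin /= patchE.
  by case: ifP => _; rewrite ?normr0.
have := @dominated_convergence _ _ R lambda setT measurableT fn
  (EFin \o f) (fun x => (`|f x|)%:E) fn_n _ fn_f _ fn_le.
case=> [||_ _ cvg2].
- exact/measurable_EFinP.
- exact: integrable_abse intf.
pose I n : \bar R := (\int[lambda]_x fn n x)%E.
have cvg3 : ((fun n => I n.+1) @ \oo --> (\int[lambda]_x (f x)%:E)%E)%classic.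
  by move: cvg2; rewrite -(cvg_shiftS I).
have E := cvg_unique _ cvg1 cvg3.
by rewrite /Rintegral -E.
Qed.

Let phiE x : phi x = normal_peak 1 * expR (- (x ^+ 2 / 2)).
Proof.
rewrite normal_pdfE ?oner_neq0 // /normal_fun subr0 expr1n.
by rewrite mulNr.
Qed.

Let phi_ge0 x : 0 <= phi x. Proof. exact: normal_pdf_ge0. Qed.

Let pow_expR_le (a : R) q x : 0 <= a -> (x ^+ 2 * a) ^+ q <= q`!%:R * expR (x ^+ 2 * a).
Proof.
move=> a0; have xa : 0 <= x ^+ 2 * a by rewrite mulr_ge0 ?sqr_ge0.
case: q => [|q]; first by rewrite expr0 fact0 mul1r -expR0 ler_expR.
rewrite -ler_pdivrMl ?ltr0n ?fact_gt0 // [leLHS]mulrC.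
by apply: le_trans (expR_ge1Dxn q xa); rewrite lerDr.
Qed.

Definition gauss_integrable f :=
  lambda.-integrable setT (EFin \o (fun x => f x * phi x)).

Definition gauss_expect f : R := (\int[lambda]_x (f x * phi x))%R.

Let measurable_phi : measurable_fun setT phi.
Proof. exact: measurable_normal_pdf. Qed.

(** The density is the square of [exp(- x^2/4)], up to a constant: one factor
    absorbs the power of [x], the other is the density of variance 2. *)
Lemma gauss_integrable_even q : gauss_integrable (fun x => x ^+ q.*2).
Proof.
pose s : R := Num.sqrt 2.
have s2 : s ^+ 2 = 2 by rewrite sqr_sqrtr.
have s0 : s != 0 by rewrite gt_eqF // sqrtr_gt0.
pose C := normal_peak 1 * (4 ^+ q * q`!%:R) / normal_peak s.
have ps : 0 < normal_peak s := normal_peak_gt0 s0.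
have hI := integrableZl measurableT C (integrable_normal_pdf 0 s).
apply: (le_integrable measurableT) hI.
  by apply/measurable_EFinP; apply: measurable_funM.
move=> x _ /=; rewrite lee_fin.
rewrite [leRHS]ger0_norm; last first.
  rewrite mulr_ge0 ?normal_pdf_ge0 // !mulr_ge0 ?invr_ge0 ?exprn_ge0 //.
rewrite ger0_norm; last by rewrite mulr_ge0 // -mul2n exprM exprn_ge0 // sqr_ge0.
rewrite (normal_pdfE _ s0) phiE /normal_fun subr0 s2 /C.
have -> : normal_peak 1 * (4 ^+ q * q`!%:R) / normal_peak s *
    (normal_peak s * expR (- x ^+ 2 / (2 *+ 2))) =
    normal_peak 1 * (4 ^+ q * (q`!%:R * expR (- (x ^+ 2 * 4^-1)))).
  rewrite (_ : 2 *+ 2 = 4); last by rewrite -mulr_natr; ring.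
  by rewrite mulNr; field; rewrite gt_eqF.
rewrite mulrCA ler_wpM2l ?normal_peak_ge0 //.
have -> : x ^+ q.*2 = 4 ^+ q * (x ^+ 2 * 4^-1) ^+ q.
  by rewrite exprMn mulrCA -exprMn divff ?expr1n ?mulr1 -?exprM ?mul2n // pnatr_eq0.
rewrite -mulrA ler_wpM2l ?exprn_ge0 //.
have -> : expR (- (x ^+ 2 / 2)) = expR (- (x ^+ 2 * 4^-1)) * expR (- (x ^+ 2 * 4^-1)).
  by rewrite -expRD; congr expR; field.
rewrite mulrA ler_wpM2r ?expR_ge0 // expRN ler_pdivrMr ?expR_gt0 //.
by apply: pow_expR_le; rewrite invr_ge0.
Qed.

Lemma gauss_integrable_le f (C : R) q : measurable_fun setT f ->
  (forall x, `|f x| <= C * (1 + x ^+ q.*2)) -> gauss_integrable f.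
Proof.
move=> mf fC.
have h0 := integrableD measurableT (gauss_integrable_even 0) (gauss_integrable_even q).
have h1 := integrableZl measurableT C h0.
apply: (le_integrable measurableT) h1; first by apply/measurable_EFinP/measurable_funM.
move=> x _ /=; rewrite lee_fin -mulrDl expr0 mulrA !normrM.
by rewrite ler_wpM2r // -normrM (le_trans (fC x)) ?ler_norm.
Qed.

Lemma gauss_integrableX p : gauss_integrable (fun x => x ^+ p).
Proof.
apply: (@gauss_integrable_le _ 1 p); first exact: measurable_funX.
move=> x; rewrite mul1r normrX -mul2n exprM -real_normK ?num_real // -exprM mulnC exprM.
have : 0 <= (`|x| ^+ p - 1 / 2) ^+ 2 by rewrite sqr_ge0.
by nra.
Qed.

Lemma gauss_integrableD f g : gauss_integrable f -> gauss_integrable g ->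
  gauss_integrable (fun x => f x + g x).
Proof.
move=> intf intg; have := integrableD measurableT intf intg.
by apply: eq_integrable => // x _; rewrite /= mulrDl.
Qed.

Lemma gauss_integrableZ c f : gauss_integrable f ->
  gauss_integrable (fun x => c * f x).
Proof.
move=> intf; have := integrableZl measurableT c intf.
by apply: eq_integrable => // x _; rewrite /= -EFinM mulrA.
Qed.

Lemma gauss_expectD f g : gauss_integrable f -> gauss_integrable g ->
  gauss_expect (fun x => f x + g x) = gauss_expect f + gauss_expect g.
Proof.
move=> intf intg; rewrite /gauss_expect -RintegralD //.
by apply: eq_Rintegral => x _; rewrite mulrDl.
Qed.

Lemma gauss_expectZ c f : gauss_integrable f ->
  gauss_expect (fun x => c * f x) = c * gauss_expect f.
Proof.
move=> intf; rewrite /gauss_expect -RintegralZl //.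
by apply: eq_Rintegral => x _; rewrite mulrA.
Qed.

Lemma le_gauss_expect f g : gauss_integrable f -> gauss_integrable g ->
  (forall x, f x <= g x) -> gauss_expect f <= gauss_expect g.
Proof.
move=> intf intg fg; apply: le_Rintegral => // x _.
by rewrite ler_wpM2r.
Qed.

Lemma gauss_expect1 : gauss_expect (fun=> 1) = 1.
Proof.
rewrite /gauss_expect /Rintegral; under eq_integral do rewrite mul1r.
by rewrite integral_normal_pdf.
Qed.

Let is_derive_phi x : is_derive x 1 phi (- x * phi x).
Proof.
have E : phi = (fun x => normal_peak 1 * expR ((- (2^-1) *: 'X^2).[x])).
  by apply/funext => t; rewrite phiE hornerZ hornerXn mulNr [2^-1 * _]mulrC.
rewrite [X in is_derive _ _ X _]E [in X in is_derive _ _ _ X]E.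
apply: (is_derive_eq (is_deriveZ (normal_peak 1)
  (is_derive1_comp (is_derive_expR _) (is_derive_poly _ x)))).
by rewrite derivZ derivXn hornerZ hornerMn hornerXn /= /GRing.scale /=; field.
Qed.

Let is_derive_Xphi p x : is_derive x 1 (fun x => x ^+ p.+1 * phi x)
  ((p.+1%:R * x ^+ p - x ^+ p.+2) * phi x).
Proof.
have -> : (fun x : R => x ^+ p.+1 * phi x) = (fun x => ('X^(p.+1)).[x] * phi x).
  by apply/funext => t; rewrite hornerXn.
apply: (is_derive_eq (is_deriveM (is_derive_poly _ x) (is_derive_phi x))).
by rewrite derivXn hornerMn !hornerXn /= /GRing.scale /= -mulr_natr !exprS; ring.
Qed.

Let Xphi_le p n : (0 < n)%N ->
  n%:R ^+ p.+1 * phi n%:R <= normal_peak 1 * (2 ^+ p.+1 * p.+1`!%:R) * n%:R^-1.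
Proof.
move=> n0; rewrite ler_pdivlMr ?ltr0n // phiE.
apply: (@le_trans _ _ (normal_peak 1 * (n%:R ^+ p.+1.*2 * expR (- (n%:R ^+ 2 / 2))))).
  rewrite (_ : _ * n%:R = normal_peak 1 * (n%:R ^+ p.+2 * expR (- (n%:R ^+ 2 / 2)))).
    rewrite ler_wpM2l ?normal_peak_ge0 // ler_wpM2r ?expR_ge0 //.
    by rewrite ler_weXn2l ?ler1n // doubleS -addnn; lia.
  by rewrite [n%:R ^+ p.+2]exprS; ring.
rewrite ler_wpM2l ?normal_peak_ge0 // expRN ler_pdivrMr ?expR_gt0 //.
have -> : n%:R ^+ p.+1.*2 = 2 ^+ p.+1 * (n%:R ^+ 2 * 2^-1) ^+ p.+1 :> R.
  by rewrite exprMn mulrCA -exprMn divff ?expr1n ?mulr1 -?exprM ?mul2n // pnatr_eq0.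
by rewrite -[leRHS]mulrA ler_wpM2l ?exprn_ge0 // pow_expR_le // invr_ge0.
Qed.

Let cvg_inv0 : ((n%:R^-1 : R) @[n --> \oo] --> 0)%classic.
Proof. by rewrite -(cvg_shiftS (fun n => n%:R^-1 : R)); exact: cvg_harmonic. Qed.

Let Xphi_cvg0 p : (n%:R ^+ p.+1 * phi n%:R @[n --> \oo] --> 0)%classic.
Proof.
apply: (@squeeze_cvgr _ _ _ _ (fun=> 0)
  (fun n => normal_peak 1 * (2 ^+ p.+1 * p.+1`!%:R) * n%:R^-1)).
- near=> n; rewrite mulr_ge0 ?exprn_ge0 //=; apply: Xphi_le.
  by near: n; exact: nbhs_infty_gt.
- exact: cvg_cst.
- rewrite -[X in (_ --> X)%classic](mulr0 (normal_peak 1 * (2 ^+ p.+1 * p.+1`!%:R))).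
  by apply: cvgM; [exact: cvg_cst|exact: cvg_inv0].
Unshelve. all: by end_near. Qed.

Let phi_cvg0 : (phi n%:R @[n --> \oo] --> 0)%classic.
Proof.
apply: (@squeeze_cvgr _ _ _ _ (fun=> 0) (fun n => n%:R ^+ 1 * phi n%:R)).
- near=> n; rewrite phi_ge0 /= expr1 ler_peMl // ler1n.
  by near: n; exact: nbhs_infty_gt.
- exact: cvg_cst.
- exact: Xphi_cvg0.
Unshelve. all: by end_near. Qed.

Let phiN x : phi (- x) = phi x.
Proof. by rewrite !phiE sqrrN. Qed.

Let continuous_phi : continuous phi.
Proof. exact: continuous_normal_pdf (oner_neq0 R). Qed.

(** The derivative of [x^(p+1) phi x] is [((p+1) x^p - x^(p+2)) phi x]. *)
Lemma gauss_expect_parts p :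
  p.+1%:R * gauss_expect (fun x => x ^+ p) = gauss_expect (fun x => x ^+ p.+2).
Proof.
apply/eqP; rewrite -subr_eq0 -gauss_expectZ; last exact: gauss_integrableX.
rewrite /gauss_expect -RintegralB //; last 2 first.
- exact: gauss_integrableZ (gauss_integrableX p).
- exact: gauss_integrableX.
under eq_Rintegral do rewrite -mulrBl.
apply/eqP/(@Rintegral_derivative_eq0 (fun x => x ^+ p.+1 * phi x)).
- exact: is_derive_Xphi.
- move=> x; apply: cvgM; last exact: continuous_phi.
  apply: cvgB; last exact: exprn_continuous.
  by apply: cvgM; [exact: cvg_cst|exact: exprn_continuous].
- have := gauss_integrableD (gauss_integrableZ p.+1%:R (gauss_integrableX p))
    (gauss_integrableZ (-1) (gauss_integrableX p.+2)).
  by apply: eq_integrable => // x _; rewrite /= mulN1r.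
- exact: Xphi_cvg0.
- rewrite (_ : (fun n => _) = (fun n => (-1) ^+ p.+1 * (n%:R ^+ p.+1 * phi n%:R))).
    rewrite -[X in (_ --> X)%classic](mulr0 ((-1) ^+ p.+1)).
    by apply: cvgM; [exact: cvg_cst|exact: Xphi_cvg0].
  by apply/funext => n; rewrite phiN [(- n%:R) ^+ _]exprNn mulrA.
Qed.

Lemma gauss_expect_odd q : gauss_expect (fun x => x ^+ q.*2.+1) = 0.
Proof.
elim: q => [|q IHq]; last by rewrite doubleS -gauss_expect_parts IHq mulr0.
rewrite /gauss_expect; apply: (@Rintegral_derivative_eq0 (fun x => - phi x)).
- move=> x; apply: (is_derive_eq (is_deriveN (is_derive_phi x))).
  by rewrite expr1 mulNr opprK.
- by move=> x; apply: cvgM; [exact: exprn_continuous|exact: continuous_phi].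
- exact: gauss_integrableX.
- by rewrite -[X in (_ --> X)%classic]oppr0; apply: cvgN; exact: phi_cvg0.
- rewrite (_ : (fun n => _) = (fun n => - phi n%:R)).
    by rewrite -[X in (_ --> X)%classic]oppr0; apply: cvgN; exact: phi_cvg0.
  by apply/funext => n; rewrite phiN.
Qed.

Lemma gauss_expect_even q : gauss_expect (fun x => x ^+ q.*2) =
  \prod_(i < q) i.*2.+1%:R.
Proof.
elim: q => [|q IHq].
  by rewrite big_ord0 -gauss_expect1; apply: eq_Rintegral => x _; rewrite expr0.
by rewrite doubleS -gauss_expect_parts IHq big_ord_recr /= mulrC.
Qed.

Lemma gauss_integrable_indic (A : set R) : measurable A ->
  gauss_integrable (\1_A).
Proof.
move=> mA; apply: (@gauss_integrable_le _ 1 0); first exact: measurable_indic.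
by move=> x; rewrite indicE expr0; case: (x \in A); rewrite /= ?normr1 ?normr0; lra.
Qed.

Lemma gauss_expect_indic (A : set R) : measurable A ->
  gauss_expect (\1_A) = fine (normal_prob 0 1 A).
Proof.
move=> mA; rewrite /gauss_expect /Rintegral /normal_prob [in RHS]integral_mkcond.
congr fine; apply: eq_integral => x _.
rewrite patchE indicE; case: (x \in A); by rewrite ?mul1r ?mul0r.
Qed.

End NormalLaw.

(** * From moments to distribution functions *)

Section CosineTaylor.

Variable R : realType.
Local Open Scope ring_scope.

Lemma integrate_bound_sym (f df : R -> R) K :
    (forall t : R, is_derive t 1 f (df t)) -> f 0 = 0 ->
    (forall t, `|df t| <= `|t| ^+ K / K`!%:R) ->
  forall z, `|f z| <= `|z| ^+ K.+1 / K.+1`!%:R.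
Proof.
move=> fd f0 dfb z; have [z0|z0] := leP 0 z.
  rewrite (ger0_norm z0) -[leRHS]mul1r; apply: (@integrate_bound R f df) => // t t0.
  by rewrite mul1r -{2}(ger0_norm t0); exact: dfb.
rewrite (ltr0_norm z0) -[leRHS]mul1r -{1}(opprK z).
apply: (@integrate_bound R (f \o -%R) (fun t => df (- t) * -1)).
- by rewrite /= oppr0.
- by move=> t t0; have := dfb (- t); rewrite normrN (ger0_norm t0) mul1r mulrN1 normrN.
- by rewrite oppr_ge0 ltW.
Qed.

Definition cos_poly K (b : R) : {poly R} :=
  \poly_(i < K) (cos (b + i%:R * (pi / 2)) / i`!%:R).

(** The phase makes the induction work: the derivative of [cos (z + b)] is
    [cos (z + (b + pi/2))]. *)
Lemma cos_taylor K b z :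
  `|cos (z + b) - (cos_poly K b).[z]| <= `|z| ^+ K / K`!%:R.
Proof.
elim: K b z => [|K IHK] b z.
  by rewrite horner_poly big_ord0 subr0 expr0 fact0 divr1 cos_max.
move: z; apply: (@integrate_bound_sym (fun z => cos (z + b) - (cos_poly K.+1 b).[z])
  (fun z => cos (z + (b + pi / 2)) - (cos_poly K (b + pi / 2)).[z])).
- move=> t.
  have d1 : is_derive t 1 (fun t : R => t + b) 1.
    apply: (is_derive_eq (is_deriveD (is_derive_id t 1) (is_derive_cst b t 1))).
    by rewrite addr0.
  apply: (is_derive_eq (is_deriveB (is_derive1_comp (is_derive_cos _) d1)
    (is_derive_poly _ t))).
  rewrite addrA cosDpihalf mulr1; congr (_ - _.[_]).
  apply/polyP => i; rewrite coef_deriv !coef_poly ltnS; case: ifP => _.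
    rewrite -[LHS]mulr_natr factS natrM invfM (_ : b + i.+1%:R * (pi / 2) =
      b + pi / 2 + i%:R * (pi / 2)); last by rewrite -natr1; ring.
    by field; rewrite pnatr_eq0 -lt0n fact_gt0 nat1r pnatr_eq0.
  by rewrite mul0rn.
- by rewrite add0r horner_coef0 coef_poly /= mul0r addr0 fact0 divr1 subrr.
- by move=> t; exact: IHK.
Qed.

End CosineTaylor.

Section MomentMethod.

Variable R : realType.
Local Open Scope ring_scope.

(** Trigonometric polynomials with arbitrary frequencies; the phase [b] makes sines
    and products expressible by cosines alone. *)
Inductive trig : (R -> R) -> Prop :=
| trig_cos c s b : trig (fun x => c * cos (s * x + b))
| trig_add f g : trig f -> trig g -> trig (fun x => f x + g x).

Lemma trig_ext f g : f =1 g -> trig f -> trig g.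
Proof. by move=> /funext ->. Qed.

Lemma trig_cst c : trig (fun=> c).
Proof. by apply: trig_ext (trig_cos c 0 0) => x; rewrite mul0r addr0 cos0 mulr1. Qed.

Lemma trigM f g : trig f -> trig g -> trig (fun x => f x * g x).
Proof.
move=> tf; elim: tf g => [c s b|f1 f2 _ IH1 _ IH2] g tg; last first.
  apply: trig_ext (trig_add (IH1 _ tg) (IH2 _ tg)) => x; ring.
elim: tg => [c' s' b'|g1 g2 _ IH1 _ IH2]; last first.
  apply: trig_ext (trig_add IH1 IH2) => x; ring.
apply: trig_ext (trig_add (trig_cos (c * c' / 2) (s + s') (b + b'))
                          (trig_cos (c * c' / 2) (s - s') (b - b'))) => x.
rewrite (_ : (s + s') * x + (b + b') = (s * x + b) + (s' * x + b')); last by ring.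
rewrite (_ : (s - s') * x + (b - b') = (s * x + b) - (s' * x + b')); last by ring.
by rewrite cosD cosB; field.
Qed.

Lemma trig_poly (p : {poly R}) w : trig w -> trig (fun x => p.[w x]).
Proof.
move=> tw; elim/poly_ind: p => [|p c IHp].
  by apply: trig_ext (trig_cst 0) => x; rewrite horner0.
apply: trig_ext (trig_add (trigM IHp tw) (trig_cst c)) => x.
by rewrite hornerMXaddC.
Qed.

Lemma gauss_integrable_horner (p : {poly R}) : gauss_integrable (fun x => p.[x]).
Proof.
rewrite (_ : (fun x => _) = (fun x => \sum_(i < size p) p`_i * x ^+ i)); last first.
  by apply/funext => x; rewrite horner_coef.
elim: (size p) => [|k IHk].
  rewrite (_ : (fun x => _) = (fun x => 0 * x ^+ 0)).
    exact: gauss_integrableZ (gauss_integrableX R 0).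
  by apply/funext => x; rewrite big_ord0 mul0r.
rewrite (_ : (fun x => _) = (fun x => \sum_(i < k) p`_i * x ^+ i + p`_k * x ^+ k)).
  by apply: gauss_integrableD => //; exact: gauss_integrableZ (gauss_integrableX R k).
by apply/funext => x; rewrite big_ord_recr.
Qed.

Lemma gauss_integrable_cos (s b : R) : gauss_integrable (fun x => cos (s * x + b)).
Proof.
apply: (@gauss_integrable_le _ _ 1 0).
  apply: continuous_measurable_fun => x.
  apply: (@continuous_comp _ _ _ (fun x : R => s * x + b) (@cos R)).
    by apply: cvgD; [apply: cvgM; [exact: cvg_cst|exact: cvg_id]|exact: cvg_cst].
  exact: continuous_cos.
by move=> x; rewrite (le_trans (cos_max _)) // expr0; lra.
Qed.

Lemma trig_gauss_integrable f : trig f -> gauss_integrable f.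
Proof.
elim=> [c s b|f1 f2 _ IH1 _ IH2]; last exact: gauss_integrableD.
exact: gauss_integrableZ (gauss_integrable_cos s b).
Qed.

(** Iterating [w |-> (3 w - w^3)/2], which has the attracting fixed points -1
    and 1 and the repelling one 0, approximates the sign function on [-1, 1]. *)
Definition steepen (w : R) : R := (3 * w - w ^+ 3) / 2.

Fixpoint steep_poly k : {poly R} :=
  if k is k'.+1 then (2^-1)%:P * (3%:P * steep_poly k' - steep_poly k' ^+ 3) else 'X.

Lemma horner_steep k w : (steep_poly k).[w] = iter k steepen w.
Proof.
elim: k => [|k IHk] /=; first by rewrite hornerX.
by rewrite -IHk /steepen hornerM hornerD hornerN horner_exp hornerM !hornerC mulrC.
Qed.

Lemma steep_polyN k w : (steep_poly k).[- w] = - (steep_poly k).[w].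
Proof.
rewrite !horner_steep; elim: k => [//|k IHk] /=.
by rewrite IHk /steepen; field.
Qed.

(** One iteration multiplies the distance to 1 by [(1 - v) (2 + v) / 2], which is
    at most [1 - zeta/2] for [v >= zeta]. *)
Lemma steep_poly_near1 k (zeta w : R) : 0 <= zeta -> zeta <= w -> w <= 1 ->
  [/\ zeta <= (steep_poly k).[w], (steep_poly k).[w] <= 1
    & 1 - (steep_poly k).[w] <= (1 - zeta / 2) ^+ k].
Proof.
move=> z0 zw w1; rewrite horner_steep; elim: k => [|k [IH1 IH2 IH3]] /=.
  by split=> //; rewrite expr0; lra.
set v := iter k steepen w in IH1 IH2 IH3 *.
have v0 : 0 <= v by apply: le_trans IH1.
have E : 1 - steepen v = (1 - v) * ((1 - v) * (2 + v) / 2) by rewrite /steepen; field.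
have E2 : steepen v - v = v * ((1 - v) * (1 + v)) / 2 by rewrite /steepen; field.
split.
- rewrite (le_trans IH1) // -subr_ge0 E2 divr_ge0 // mulr_ge0 // mulr_ge0 //; lra.
- by rewrite -subr_ge0 E mulr_ge0 ?divr_ge0 ?mulr_ge0 //; lra.
- rewrite E exprSr ler_pM //; first by lra.
    by rewrite divr_ge0 ?mulr_ge0 //; lra.
  by nra.
Qed.

Lemma steep_poly_le1 k w : `|w| <= 1 -> `|(steep_poly k).[w]| <= 1.
Proof.
have H u : 0 <= u -> u <= 1 -> `|(steep_poly k).[u]| <= 1.
  move=> u0 u1; have [h1 h2 _] := steep_poly_near1 k (lexx 0) u0 u1.
  by rewrite ger0_norm.
have [w0|w0] := leP 0 w; first by move=> w1; apply: H => //; rewrite -(ger0_norm w0).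
rewrite ltr0_norm // => w1; rewrite -normrN -steep_polyN; apply: H => //.
by rewrite oppr_ge0 ltW.
Qed.

Lemma steep_poly_approx (zeta eps : R) : 0 < zeta -> zeta <= 1 -> 0 < eps ->
  exists k, forall w, zeta <= w -> w <= 1 -> 1 - (steep_poly k).[w] <= eps.
Proof.
move=> z0 z1 e0.
have : ((1 - zeta / 2) ^+ k @[k --> \oo] --> 0)%classic.
  by apply: cvg_expr; rewrite ger0_norm; lra.
move=> /cvgrPdist_lt /(_ eps e0)[k _ /(_ k (leqnn k)) /= hk]; exists k => w zw w1.
have [_ _ h] := steep_poly_near1 k (ltW z0) zw w1.
apply: le_trans h (ltW _); apply: le_lt_trans hk.
by rewrite sub0r normrN ler_norm.
Qed.

(** Near [a] the steep function of [sin (s (y - a))] is close to a step; the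
    quadratic term covers the points where the sine has turned back. *)
Lemma trig_step (a eta eps : R) : 0 < eta -> 0 < eps ->
  exists u s, [/\ trig u, s ^+ 2 * (1 + a ^+ 2) <= eps,
    (forall y, (y <= a - eta)%R%:R <= u y + eps + s ^+ 2 * (y - a) ^+ 2)
  & (forall y, u y <= (y <= a + eta)%R%:R + eps + s ^+ 2 * (y - a) ^+ 2)].
Proof.
move=> eta0 eps0.
have pih1 : 1 <= pi / 2 :> R := pihalf_ge1 R.
have [s s0 [s1 s2]] : exists2 s : R, 0 < s & s * eta <= 1 /\ s ^+ 2 * (1 + a ^+ 2) <= eps.
  pose s := Num.min eta^-1 (Num.min 1 (eps / (1 + a ^+ 2))).
  have a1 : 0 < 1 + a ^+ 2 by rewrite ltr_pwDl ?sqr_ge0.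
  have s0 : 0 < s by rewrite !lt_min invr_gt0 eta0 ltr01 divr_gt0.
  exists s => //; split.
    by rewrite -ler_pdivlMr // div1r ge_min lexx.
  rewrite -ler_pdivlMr //; apply: (@le_trans _ _ s).
    by rewrite expr2 ler_piMr ?(ltW s0) // !ge_min lexx orbT.
  by rewrite !ge_min lexx !orbT.
pose zeta := sin (s * eta).
have se0 : 0 < s * eta by rewrite mulr_gt0.
have zeta0 : 0 < zeta.
  by apply: sin_gt0_pi; rewrite se0 /=; lra.
have sin_ge t : eta <= t -> s * t <= pi / 2 -> zeta <= sin (s * t).
  move=> et st; have st2 : s * eta <= s * t by rewrite ler_pM2l.
  by rewrite leNgt ltr_sin -?leNgt // in_itv /=; apply/andP; split; lra.
have [k kP] := steep_poly_approx zeta0 (sin_le1 _) eps0.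
pose w y := sin (s * (y - a)).
pose u y := (1 - (steep_poly k).[w y]) / 2.
have w1 y : `|w y| <= 1 := sin_max _.
have u0 y : 0 <= u y.
  by have := steep_poly_le1 k (w1 y); rewrite ler_norml /u => /andP[]; lra.
have u1 y : u y <= 1.
  by have := steep_poly_le1 k (w1 y); rewrite ler_norml /u => /andP[]; lra.
have far y : pi / 2 < s * `|y - a| -> 1 <= s ^+ 2 * (y - a) ^+ 2.
  move=> h; rewrite -(real_normK (num_real (y - a))) -exprMn.
  by rewrite exprn_ege1 //; lra.
exists u, s; split=> // [|y|y].
- have tw : trig w.
    apply: trig_ext (trig_cos 1 s (- (s * a) - pi / 2)) => y.
    by rewrite mul1r addrA cosBpihalf /w mulrBr.
  apply: trig_ext (trig_add (trig_cst 2^-1)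
    (trigM (trig_cst (- 2^-1)) (trig_poly (steep_poly k) tw))) => y.
  by rewrite /u; field.
- have q0 : 0 <= s ^+ 2 * (y - a) ^+ 2 by rewrite mulr_ge0 ?sqr_ge0.
  have [ya|ya] /= := leP y (a - eta); last by have := u0 y; lra.
  have [near|/far] := leP (s * `|y - a|) (pi / 2); last by have := u0 y; lra.
  have ay : `|y - a| = a - y by rewrite distrC ger0_norm //; lra.
  rewrite ay in near.
  have h : zeta <= sin (s * (a - y)) by apply: sin_ge => //; lra.
  have := kP _ h (sin_le1 _).
  have -> : s * (a - y) = - (s * (y - a)) by ring.
  by rewrite sinN steep_polyN -/(w y) /u; lra.
- have q0 : 0 <= s ^+ 2 * (y - a) ^+ 2 by rewrite mulr_ge0 ?sqr_ge0.
  have [ya|ya] /= := leP y (a + eta); first by have := u1 y; lra.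
  have [near|/far] := leP (s * `|y - a|) (pi / 2); last by have := u1 y; lra.
  have ay : `|y - a| = y - a by rewrite ger0_norm //; lra.
  rewrite ay in near.
  have h : zeta <= w y by apply: sin_ge => //; lra.
  by have := kP _ h (sin_le1 _); rewrite /u; lra.
Qed.

Section Convergence.

Variable E : nat -> (R -> R) -> R.
Hypothesis ED : forall n f g, E n (fun x => f x + g x) = E n f + E n g.
Hypothesis EZ : forall n c f, E n (fun x => c * f x) = c * E n f.
Hypothesis E1 : forall n, E n (fun=> 1) = 1.
Hypothesis le_E : forall n f g, (forall x, f x <= g x) -> E n f <= E n g.
Hypothesis E_moments : forall p,
  (E n (fun x => x ^+ p) @[n --> \oo] --> gauss_expect (fun x : R => x ^+ p))%classic.

Local Notation E_cvg f := (E n f @[n --> \oo] --> gauss_expect f)%classic.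

Lemma E_cvgD (f g : R -> R) : gauss_integrable f -> gauss_integrable g ->
  E_cvg f -> E_cvg g -> E_cvg (fun x => f x + g x).
Proof.
move=> intf intg cf cg; rewrite gauss_expectD //.
by under eq_fun do rewrite ED; apply: cvgD.
Qed.

Lemma E_cvgZ c (f : R -> R) : gauss_integrable f -> E_cvg f ->
  E_cvg (fun x => c * f x).
Proof.
move=> intf cf; rewrite gauss_expectZ //.
by under eq_fun do rewrite EZ; apply: cvgM => //; exact: cvg_cst.
Qed.

Lemma E_cvg_poly (p : {poly R}) : E_cvg (fun x => p.[x]).
Proof.
rewrite (_ : (fun x => p.[x]) = (fun x => \sum_(i < size p) p`_i * x ^+ i)); last first.
  by apply/funext => x; rewrite horner_coef.
have int k : gauss_integrable (fun x => \sum_(i < k) p`_i * x ^+ i).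
  have := gauss_integrable_horner (\poly_(i < k) p`_i).
  by rewrite (_ : (fun x => _.[x]) = (fun x => \sum_(i < k) p`_i * x ^+ i)) //;
    apply/funext => x; rewrite horner_poly.
elim: (size p) => [|k IHk].
  rewrite (_ : (fun x => _) = (fun x => 0 * x ^+ 0)).
    by apply: E_cvgZ; [exact: gauss_integrableX|exact: E_moments].
  by apply/funext => x; rewrite big_ord0 mul0r.
rewrite (_ : (fun x => _) = (fun x => \sum_(i < k) p`_i * x ^+ i + p`_k * x ^+ k)).
  apply: E_cvgD => //; first exact: gauss_integrableZ (gauss_integrableX R k).
  by apply: E_cvgZ; [exact: gauss_integrableX|exact: E_moments].
by apply/funext => x; rewrite big_ord_recr.
Qed.

(** Both expectations are compared with that of a Taylor polynomial of degree less
    than [2 q].  The remainder is at most [(s x)^(2 q) / (2 q)!], with Gaussian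
    expectation [(s^2/2)^q / q!], which is small for large [q]. *)
Lemma E_cvg_cos (s b : R) : E_cvg (fun x => cos (s * x + b)).
Proof.
apply/cvgrPdist_le => eps eps0.
pose e := eps / 4; have e0 : 0 < e by rewrite divr_gt0.
pose m q := gauss_expect (fun x : R => x ^+ q.*2).
pose c q : R := s ^+ q.*2 / q.*2`!%:R.
have cmE q : c q * m q = exp_coeff (s ^+ 2 / 2) q.
  rewrite /c /m gauss_expect_even /exp_coeff /=.
  have fE : q.*2`!%:R = (\prod_(i < q) i.*2.+1%:R) * (2 ^+ q * q`!%:R) :> R.
    elim: q => [|q IHq]; first by rewrite big_ord0 !expr0 fact0 !mulr1.
    rewrite doubleS !factS !natrM IHq big_ord_recr /= exprS.
    by rewrite -!natr1 -muln2 natrM; ring.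
  have P0 : \prod_(i < q) i.*2.+1%:R != 0 :> R.
    by apply/prodf_neq0 => i _; rewrite pnatr_eq0.
  rewrite fE exprMn exprVn -exprM mul2n; field.
  by rewrite P0 pnatr_eq0 -lt0n fact_gt0 expf_neq0 // pnatr_eq0.
have [q qP] : exists q, c q * m q < e.
  have := cvg_series_cvg_0 (is_cvg_series_exp_coeff (s ^+ 2 / 2)).
  move=> /cvgrPdist_lt /(_ e e0)[q _ /(_ q (leqnn q)) /= hq]; exists q.
  by rewrite cmE; apply: le_lt_trans hq; rewrite sub0r normrN ler_norm.
pose p := cos_poly q.*2 b \Po (s *: 'X).
have pP x : `|cos (s * x + b) - p.[x]| <= c q * x ^+ q.*2.
  rewrite horner_comp hornerZ hornerX (le_trans (cos_taylor _ _ _)) //.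
  rewrite -mul2n exprM real_normK ?num_real // -exprM mul2n exprMn mulrAC.
  by [].
have intc := gauss_integrable_cos s b.
have intp := gauss_integrable_horner p.
have intX := gauss_integrableX R q.*2.
have intcX := gauss_integrableZ (c q) intX.
have bound1 : `|gauss_expect (fun x => cos (s * x + b)) - gauss_expect (fun x => p.[x])|
    <= c q * m q.
  rewrite /m -gauss_expectZ // ler_distl; apply/andP; split.
    rewrite lerBlDr -gauss_expectD //; apply: le_gauss_expect => //.
      exact: gauss_integrableD.
    by move=> x; have := pP x; rewrite ler_norml; lra.
  rewrite -gauss_expectD //; apply: le_gauss_expect => //.
    exact: gauss_integrableD.
  by move=> x; have := pP x; rewrite ler_norml; lra.
have bound2 n : `|E n (fun x => cos (s * x + b)) - E n (fun x => p.[x])|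
    <= c q * E n (fun x => x ^+ q.*2).
  rewrite -EZ ler_distl; apply/andP; split.
    rewrite lerBlDr -ED; apply: le_E => x.
    by have := pP x; rewrite ler_norml; lra.
  by rewrite -ED; apply: le_E => x; have := pP x; rewrite ler_norml; lra.
have cvg1 := @E_cvgZ (c q) _ intX (@E_moments q.*2).
have cvg2 := @E_cvg_poly p.
near=> n.
have h1 : c q * E n (fun x => x ^+ q.*2) < e + e.
  have : `|gauss_expect (fun x => c q * x ^+ q.*2) - E n (fun x => c q * x ^+ q.*2)| < e.
    by near: n; move/cvgrPdist_lt : cvg1; exact.
  rewrite gauss_expectZ // EZ -/(m q) ltr_norml; lra.
have h2 : `|gauss_expect (fun x => p.[x]) - E n (fun x => p.[x])| < e.
  by near: n; move/cvgrPdist_lt : cvg2; exact.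
have h3 := bound2 n; rewrite distrC in h3.
have := ler_distD (E n (fun x => p.[x])) (gauss_expect (fun x => cos (s * x + b)))
  (E n (fun x => cos (s * x + b))).
have := ler_distD (gauss_expect (fun x => p.[x])) (gauss_expect (fun x => cos (s * x + b)))
  (E n (fun x => p.[x])).
by rewrite (_ : eps = e + e + e + e); [lra|rewrite /e; field].
Unshelve. all: by end_near. Qed.

Lemma E_cvg_trig f : trig f -> E_cvg f.
Proof.
elim=> [c s b|f1 f2 t1 c1 t2 c2].
  by apply: E_cvgZ; [exact: gauss_integrable_cos|exact: E_cvg_cos].
by apply: E_cvgD => //; exact: trig_gauss_integrable.
Qed.

Let G x : R := fine (normal_prob 0 1 `]-oo, x]%classic).

Let gauss_step (x : R) : gauss_integrable (fun y => (y <= x)%R%:R) /\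
  gauss_expect (fun y => (y <= x)%R%:R) = G x.
Proof.
rewrite (_ : (fun y => _) = \1_(`]-oo, x]%classic)).
  by split; [exact: gauss_integrable_indic|exact: gauss_expect_indic].
by apply/funext => y; rewrite indicE; congr (_%:R); rewrite mem_setE in_itv.
Qed.

Let gauss_sqr (a : R) : gauss_expect (fun x => (x - a) ^+ 2) = 1 + a ^+ 2 /\
  gauss_integrable (fun x => (x - a) ^+ 2).
Proof.
have i1 := gauss_integrableX R 2; have i2 := gauss_integrableZ (- 2 * a) (gauss_integrableX R 1).
have i3 := gauss_integrableZ (a ^+ 2) (gauss_integrableX R 0).
have -> : (fun x => (x - a) ^+ 2) =
    (fun x => x ^+ 2 + (- 2 * a * x ^+ 1 + a ^+ 2 * x ^+ 0)).
  by apply/funext => x; rewrite expr1 expr0; ring.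
have i23 := gauss_integrableD i2 i3; split; last exact: gauss_integrableD.
rewrite !gauss_expectD // !gauss_expectZ ?gauss_integrableX //.
rewrite (gauss_expect_odd R 0) (gauss_expect_even R 1) (gauss_expect_even R 0).
by rewrite big_ord1 big_ord0 mulr0 add0r mulr1.
Qed.

(** The step at [x] is squeezed between the trigonometric steps of [trig_step] at
    [x - eta] and [x + eta], whose expectations converge; these lie in turn between
    the Gaussian probabilities at [x - 2 eta] and [x + 2 eta]. *)
Theorem moment_method x : {for x, continuous G} ->
  (E n (fun y => (y <= x)%R%:R) @[n --> \oo] --> G x)%classic.
Proof.
move=> cG; apply/cvgrPdist_le => eps eps0.
have [d d0 epsE] : exists2 d : R, 0 < d & eps = 6 * d.
  by exists (eps / 6); [rewrite divr_gt0|field].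
have [eta eta0 etaP] : exists2 eta : R, 0 < eta & forall y, `|x - y| <= 2 * eta -> `|G x - G y| < d.
  move/cvgrPdist_lt : cG => /(_ d d0) /nbhs_ballP[r /= r0 rP].
  exists (r / 4); first by rewrite divr_gt0.
  by move=> y xy; apply: rP; rewrite /ball /=; lra.
have G1 : G (x + 2 * eta) < G x + d.
  have := etaP (x + 2 * eta); rewrite opprD addNKr normrN ger0_norm ?lexx; last by lra.
  by move=> /(_ isT); rewrite ltr_norml; lra.
have G2 : G x - d < G (x - 2 * eta).
  have := etaP (x - 2 * eta); rewrite opprB addrC subrK ger0_norm ?lexx; last by lra.
  by move=> /(_ isT); rewrite ltr_norml; lra.
have [u [s [tu su u1 u2]]] := trig_step (x + eta) eta0 d0.
have [u' [s' [tu' su' u1' u2']]] := trig_step (x - eta) eta0 d0.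
have intu := trig_gauss_integrable tu; have intu' := trig_gauss_integrable tu'.
have [q1 q2] := gauss_sqr (x + eta); have [q1' q2'] := gauss_sqr (x - eta).
have [gi1 g1] := gauss_step (x + 2 * eta); have [gi2 g2] := gauss_step (x - 2 * eta).
have i1 := trig_gauss_integrable (trig_cst d).
have gd : gauss_expect (fun=> d : R) = d.
  have := gauss_expectZ d (gauss_integrableX R 0).
  rewrite (_ : (fun x => d * x ^+ 0) = (fun=> d)).
    by move=> ->; rewrite (gauss_expect_even R 0) big_ord0 mulr1.
  by apply/funext => t; rewrite expr0 mulr1.
have Gu : gauss_expect u <= G (x + 2 * eta) + d + d.
  apply: (@le_trans _ _ (gauss_expect (fun y => (y <= x + 2 * eta)%R%:R + d
     + s ^+ 2 * (y - (x + eta)) ^+ 2))).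
    apply: le_gauss_expect => // [|y].
      apply: gauss_integrableD; first exact: gauss_integrableD.
      exact: gauss_integrableZ.
    by rewrite (_ : x + 2 * eta = x + eta + eta); [exact: u2|ring].
  rewrite gauss_expectD ?gauss_expectD ?gauss_expectZ //.
  - by rewrite g1 gd q1 lerD2l.
  - exact: gauss_integrableD.
  - exact: gauss_integrableZ.
have Gu' : G (x - 2 * eta) - d - d <= gauss_expect u'.
  rewrite !lerBlDr; apply: (@le_trans _ _ (gauss_expect (fun y => u' y + d
     + s' ^+ 2 * (y - (x - eta)) ^+ 2))).
    rewrite -g2; apply: le_gauss_expect => // [|y].
      apply: gauss_integrableD; first exact: gauss_integrableD.
      exact: gauss_integrableZ.
    by rewrite (_ : x - 2 * eta = x - eta - eta); [exact: u1'|ring].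
  rewrite gauss_expectD ?gauss_expectD ?gauss_expectZ //.
  - by rewrite gd q1' lerD2l.
  - exact: gauss_integrableD.
  - exact: gauss_integrableZ.
have Ed n : E n (fun=> d) = d.
  by rewrite -[RHS]mulr1 -(E1 n) -EZ; congr (E n _); apply/funext => t; rewrite mulr1.
have sqr_cvg (a : R) (r : R) : (r ^+ 2 * E n (fun y => (y - a) ^+ 2) @[n --> \oo] -->
    r ^+ 2 * (1 + a ^+ 2))%classic.
  apply: cvgM; first exact: cvg_cst.
  rewrite -(gauss_sqr a).1; have := @E_cvg_poly (('X - a%:P) ^+ 2).
  rewrite (_ : (fun y => (('X - a%:P) ^+ 2).[y]) = (fun y => (y - a) ^+ 2)) //.
  by apply/funext => y; rewrite horner_exp hornerXsubC.
have c1 := E_cvg_trig tu; have c2 := E_cvg_trig tu'.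
have c3 := @sqr_cvg (x + eta) s; have c4 := @sqr_cvg (x - eta) s'.
near=> n.
have k1 : E n (fun y => (y <= x)%R%:R) <=
    E n u + d + s ^+ 2 * E n (fun y => (y - (x + eta)) ^+ 2).
  rewrite -{1}(Ed n) -EZ -!ED; apply: le_E => y.
  by have := u1 y; rewrite addrK.
have k2 : E n u' <= E n (fun y => (y <= x)%R%:R) + d
    + s' ^+ 2 * E n (fun y => (y - (x - eta)) ^+ 2).
  rewrite -{1}(Ed n) -EZ -!ED; apply: le_E => y.
  by have := u2' y; rewrite subrK.
have l1 : `|gauss_expect u - E n u| < d / 2.
  by near: n; move/cvgrPdist_lt : c1; apply; rewrite divr_gt0.
have l2 : `|gauss_expect u' - E n u'| < d / 2.
  by near: n; move/cvgrPdist_lt : c2; apply; rewrite divr_gt0.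
have l3 : `|s ^+ 2 * (1 + (x + eta) ^+ 2) - s ^+ 2 * E n (fun y => (y - (x + eta)) ^+ 2)| < d / 2.
  by near: n; move/cvgrPdist_lt : c3; apply; rewrite divr_gt0.
have l4 : `|s' ^+ 2 * (1 + (x - eta) ^+ 2) - s' ^+ 2 * E n (fun y => (y - (x - eta)) ^+ 2)| < d / 2.
  by near: n; move/cvgrPdist_lt : c4; apply; rewrite divr_gt0.
move: l1 l2 l3 l4; rewrite !ltr_norml ler_norml => /andP[l1 l1'] /andP[l2 l2'].
move=> /andP[l3 l3'] /andP[l4 l4'].
by apply/andP; split; lra.
Unshelve. all: by end_near. Qed.

End Convergence.

End MomentMethod.

(** * The uniform random tree *)

Section UniformTrees.

Variable R : realType.
Local Open Scope ring_scope.
Local Notation e := (expR 1 : R).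
Local Notation mu := (e - 2).
Local Notation sigma2 := (e ^+ 2 - 3 * e + 1).
Local Notation sigma := (Num.sqrt sigma2).

Lemma sigma2_gt0 : 0 < sigma2.
Proof.
have e1 : 21 / 8 <= e.
  (* [e >= (1 + 1/16)^16 > 21/8], by four squarings with rounding, while the
     larger root of [t^2 - 3 t + 1] is [(3 + sqrt 5)/2 < 21/8] *)
  pose a : R := expR (16^-1).
  have a1 : 17 / 16 <= a by have := expR_ge1Dx (16^-1 : R); rewrite -/a; lra.
  have -> : e = (((a ^+ 2) ^+ 2) ^+ 2) ^+ 2.
    by rewrite -!exprM -expRM_natl; congr expR; rewrite divff // pnatr_eq0.
  have sq (c d x : R) : 0 <= c -> d <= c ^+ 2 -> c <= x -> d <= x ^+ 2.
    by move=> c0 dc cx; apply: le_trans dc _; rewrite lerXn2r ?nnegrE //; lra.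
  apply: (sq (1623 / 1000)); [lra|lra|].
  apply: (sq (1274 / 1000)); [lra|lra|].
  apply: (sq (17 / 16 * (17 / 16))); [lra|lra|].
  by apply: (sq (17 / 16)); [lra|lra|].
by nra.
Qed.

Lemma card_rooted_trees n : (0 < n)%N -> #|rooted_trees n|%:R = (n ^ n.-1)%:R :> R.
Proof. by move=> n0; rewrite -tree_sum_Cayley // /tree_sum sumr_const. Qed.

Lemma unif_expect_tree n (h : nat -> R) : (0 < n)%N ->
  unif_expect (rooted_trees n) (fun T => h (nb_improper T)) = tree_expect n h.
Proof. by move=> n0; rewrite /unif_expect card_rooted_trees. Qed.

Lemma unif_prob_tree n (P : R -> bool) : (0 < n)%N ->
  unif_prob R (rooted_trees n) (fun T => P (X R n T)) =
  tree_expect n (fun k => (P k%:R)%:R).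
Proof.
move=> n0; rewrite -unif_expect_tree // /unif_prob /unif_expect; congr (_ / _).
rewrite -sum1_card natr_sum big_mkcond [RHS]big_mkcond; apply: eq_bigr => T _ /=.
by rewrite inE; case: (T \in rooted_trees n) => //=; rewrite /X; case: (P _).
Qed.

Lemma unif_var_tree n : (0 < n)%N ->
  unif_var (rooted_trees n) (X R n) =
  tree_expect n (fun k => k%:R ^+ 2) - tree_expect n (fun k => k%:R) ^+ 2.
Proof.
move=> n0; rewrite /unif_var (unif_expect_tree (fun k => k%:R)) //.
set m := tree_expect n _.
rewrite (unif_expect_tree (fun k => (k%:R - m) ^+ 2)) //.
rewrite (@eq_tree_expect _ _ _ (fun k => k%:R ^+ 2 + (- 2 * m * k%:R + m ^+ 2 * 1))).
  by rewrite !tree_expectD !tree_expectZ tree_expect1 // -/m; ring.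
by move=> k; ring.
Qed.

Lemma bigOinv_eqO (f : nat -> R) :
  bigOinv 1 f -> (f =O_\oo (fun n : nat => n%:R^-1 : R))%classic.
Proof.
move=> /bigOinv_ge0[C C0 fC]; apply/eqO_exP; exists (C + 1); first by rewrite ltr_pwDr.
near=> n; have n0 : (0 < n)%N by near: n; exact: nbhs_infty_gt.
rewrite (le_trans (fC n n0)) // expr1 (@ger0_norm _ n%:R^-1) ?invr_ge0 //.
by rewrite ler_wpM2r ?invr_ge0 // lerDl.
Unshelve. all: by end_near. Qed.

Lemma expands_to_cvg (f : nat -> R) l : expands_to f l ->
  (f n.+1 @[n --> \oo] --> l)%classic.
Proof.
move=> [_ /bigOinv_ge0[C C0 fC]].
apply/cvgrPdist_le => eps eps0; near=> n.
rewrite distrC (le_trans (fC n.+1 isT)) // expr1 ler_pdivrMr ?ltr0n //.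
rewrite mulrC -ler_pdivrMr //.
have h : (Num.bound (C / eps) <= n)%N by near: n; exact: nbhs_infty_ge.
rewrite (le_trans (ltW (archi_boundP _))) ?divr_ge0 ?(ltW eps0) //.
by rewrite ler_nat (leq_trans h).
Unshelve. all: by end_near. Qed.

(** The index is shifted because there is no tree without vertices. *)
Definition normalized_expect (n : nat) (f : R -> R) : R :=
  tree_expect n.+1
    (fun k => f ((k%:R - mu * n.+1%:R) / (sigma * Num.sqrt n.+1%:R))).

Lemma normalized_moment p n : normalized_expect n (fun x => x ^+ p) =
  cmoment R p n.+1 / (sigma * Num.sqrt n.+1%:R) ^+ p.
Proof.
rewrite mulrC -tree_expectZ; apply: eq_tree_expect => k.
by rewrite expr_div_n mulrC.
Qed.

Let scaleE n q : (sigma * Num.sqrt n.+1%:R) ^+ q.*2 = sigma2 ^+ q * n.+1%:R ^+ q.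
Proof.
by rewrite -mul2n exprM [(_ * _) ^+ 2]exprMn !sqr_sqrtr ?ler0n ?(ltW sigma2_gt0) // exprMn.
Qed.

Let gauss_momentE q : gauss_moment R q = sigma2 ^+ q * \prod_(i < q) i.*2.+1%:R.
Proof.
elim: q => [|q IHq]; first by rewrite big_ord0 expr0 mulr1.
by rewrite big_ord_recr (exprS _ q) [LHS]/= IHq /=; ring.
Qed.

Let inv_sqrt_cvg0 : ((Num.sqrt n.+1%:R)^-1 @[n --> \oo] --> (0 : R))%classic.
Proof.
have := @cvg_comp _ _ _ (fun n : nat => n.+1%:R^-1 : R) Num.sqrt _ _ _
  (@cvg_harmonic R) (@sqrt_continuous R 0).
rewrite sqrtr0; apply: cvg_trans; apply: near_eq_cvg; apply: nearW => n /=.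
by rewrite sqrtrV.
Qed.

(** For odd [p] the centred moment has size [n^((p-1)/2)], one factor [sqrt n] less
    than the normalization. *)
Lemma normalized_moment_cvg p :
  (normalized_expect n (fun x => x ^+ p) @[n --> \oo] -->
   gauss_expect (fun x : R => x ^+ p))%classic.
Proof.
have [ep epq] := cmoment_expands R p.
rewrite -(odd_double_half p) in ep epq *; set q := p./2 in ep epq *.
case: (odd p) ep epq => ep epq; last first.
  rewrite add0n in ep epq *; have /expands_to_cvg hc := epq q erefl.
  rewrite doubleK in hc; rewrite gauss_expect_even.
  have s0 : sigma2 ^+ q != 0 by rewrite expf_neq0 // gt_eqF // sigma2_gt0.
  have -> : \prod_(i < q) i.*2.+1%:R = gauss_moment R q / sigma2 ^+ q.
    by rewrite gauss_momentE mulrC mulKf.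
  rewrite (_ : (fun n => _) = (fun n =>
      (n.+1%:R^-1 ^+ q * cmoment R q.*2 n.+1) * (sigma2 ^+ q)^-1)).
    by apply: cvgM => //; exact: cvg_cst.
  by apply/funext => n; rewrite normalized_moment scaleE invfM exprVn; ring.
rewrite add1n in ep epq *; rewrite gauss_expect_odd.
have [l /expands_to_cvg hc] := expandable_lim ep.
rewrite /= uphalf_double in hc.
rewrite (_ : (fun n => _) = (fun n =>
    (n.+1%:R^-1 ^+ q * cmoment R q.*2.+1 n.+1) * (sigma2 ^+ q * sigma)^-1
    * (Num.sqrt n.+1%:R)^-1)).
  rewrite -[X in (_ --> X)%classic](mulr0 (l * (sigma2 ^+ q * sigma)^-1)).
  apply: cvgM; last exact: inv_sqrt_cvg0.
  by apply: cvgM => //; exact: cvg_cst.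
by apply/funext => n; rewrite normalized_moment exprS scaleE !invfM exprVn; ring.
Qed.

Theorem normalized_cvg :
  cvg_in_distribution
    (fun n x => normalized_expect n (fun y => (y <= x)%R%:R)) (normal_prob 0 1).
Proof.
move=> /= x cx; apply: moment_method => //.
- by move=> n f g; exact: tree_expectD.
- by move=> n c f; exact: tree_expectZ.
- by move=> n; exact: tree_expect1.
- move=> n f g fg; rewrite /normalized_expect /tree_expect /tree_sum.
  by rewrite ler_wpM2r ?invr_ge0 // ler_sum.
- exact: normalized_moment_cvg.
Qed.

End UniformTrees.

Local Open Scope classical_set_scope.
Local Open Scope ring_scope.

Theorem theorem1p1 (R : realType) :
  let e : R := expR 1 in
  let mu : R := e - 2 in
  let sigma2 : R := e ^+ 2 - 3 * e + 1 in
  let sigma : R := Num.sqrt sigma2 in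
  [/\ 0 < sigma,
      (fun n : nat => unif_expect (rooted_trees n) (X R n)
                      - (mu * n%:R - e / 2)) =O_\oo (fun n => n%:R^-1 : R),
      (fun n : nat => unif_var (rooted_trees n) (X R n)
                      - (sigma2 * n%:R + e * (3 - e) / 2))
        =O_\oo (fun n => n%:R^-1 : R)
    & cvg_in_distribution
        (fun (n : nat) (x : R) => unif_prob R (rooted_trees n)
           (fun T => (X R n T - mu * n%:R) / (sigma * Num.sqrt n%:R) <= x))
        (normal_prob 0 1)].
Proof.
move=> e mu sigma2 sigma; split.
- by rewrite sqrtr_gt0; exact: sigma2_gt0.
- apply: bigOinv_eqO; apply: eq_bigOinv (mean_expands R) => n n0.
  by rewrite (unif_expect_tree (fun k => k%:R)).
- apply: bigOinv_eqO; apply: eq_bigOinv (variance_expands R) => n n0.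
  by rewrite unif_var_tree.
- move=> /= x cG; have := @normalized_cvg R x cG.
  rewrite -[X in _ -> X](cvg_shiftS (fun n => unif_prob R (rooted_trees n)
    (fun T => (X R n T - mu * n%:R) / (sigma * Num.sqrt n%:R) <= x))).
  apply: cvg_trans; apply: near_eq_cvg; apply: nearW => n /=.
  by rewrite (unif_prob_tree (fun y => (y - mu * n.+1%:R) / (sigma * Num.sqrt n.+1%:R) <= x)).
Qed.
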